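(* Let $n\ge3$ and $m=\lfloor n/2\rfloor$. The map $$P^{\mathrm{AI}}:\bigsqcup_{\lambda\in\mathrm{Par}_n}\mathrm{SST}_n(\lambda)\to\bigsqcup_{\rho\in\mathrm{Par}_m}\mathrm{SST}_n^{\mathrm{AI}}(\rho);\quad T\mapsto P^{\mathrm{AI}}(T)$$ is a morphism of $\mathrm{AI}$-crystals; that is, setting $P^{\mathrm{AI}}(0)=0$, one has $P^{\mathrm{AI}}(\widetilde B_iT)=\widetilde B_iP^{\mathrm{AI}}(T)$ and $\deg_i(P^{\mathrm{AI}}(T))=\deg_i(T)$ for all $T$ and all $i\in\{1,\dots,n-1\}$.
   Context: Tableaux and words. $\mathrm{Par}_l$ is the set of partitions of length $\ell(\lambda)\le l$. $\mathrm{SST}_n(\lambda)$ is the set of semistandard Young tableaux of shape $\lambda$ with entries in $\{1,\dots,n\}$; $d_j$ is the length of the $j$-th column of the diagram. The column reading $\mathrm{CR}(T)$ reads the columns left to right, each from bottom to top. $P(w)$ is the Robinson–Schensted $P$-symbol of a word $w$ (successive Schensted row insertion of its letters into the empty tableau). Operators. For $i\in\{1,\dots,n-1\}$ and a word $w$, keep only letters $i,i+1$ and successively delete adjacent pairs $(i+1),i$ (an $i+1$ immediately left of an $i$ among the remaining letters) until $i^{a}(i+1)^{b}$ is left; $\varphi_i(w)=a$, $\varepsilon_i(w)=b$; $\widetilde F_i w$ changes the rightmost undeleted $i$ into $i+1$ ($0$ if $a=0$), $\widetilde E_iw$ changes the leftmost undeleted $i+1$ into $i$ ($0$ if $b=0$).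 For $T\in\mathrm{SST}_n(\lambda)$, $\varphi_i,\varepsilon_i$ are those of $\mathrm{CR}(T)$, and $\widetilde E_iT,\widetilde F_iT$ are the tableaux of shape $\lambda$ (or $0$) with column readings $\widetilde E_i\mathrm{CR}(T),\widetilde F_i\mathrm{CR}(T)$. The $\mathrm{AI}$-crystal structure on $\mathrm{SST}_n(\lambda)$ is: $\deg_i(T)=\varepsilon_i(T)$, $\widetilde B_iT=\widetilde E_iT$ if $\varphi_i(T)$ is even; $\deg_i(T)=\varepsilon_i(T)+1$, $\widetilde B_iT=\widetilde F_iT$ if $\varphi_i(T)$ is odd. The map $K_1$. For a column $C$ with entry set $J\subset\{1,\dots,n\}$ (possibly empty), $K(C)$ is the column with entry set $\{1,\dots,n\}\setminus J$. For $T\in\mathrm{SST}_n(\lambda)$ with columns $C_1,C_2,\dots,C_{\lambda_1}$ (for $\lambda=\emptyset$ take $C_1$ to be the empty column), $K_1(T):=P(\mathrm{CR}(K(C_1))*\mathrm{CR}(C_2)*\cdots*\mathrm{CR}(C_{\lambda_1}))$, where $*$ is concatenation. $\mathrm{AI}$-tableaux. $T\in\mathrm{SST}_n(\lambda)$ (entries $t_{i,j}$) is an $\mathrm{AI}$-tableau if $d_1\le m$ and $t^c_{i,1}\le t_{i,2}$ for all $1\le i\le d_2$, where $t^c_{1,1}<\dots<t^c_{n-d_1,1}$ are the elements of $\{1,\dots,n\}\setminus\{t_{1,1},\dots,t_{d_1,1}\}$. $\mathrm{SST}_n^{\mathrm{AI}}(\lambda)$ is the set of $\mathrm{AI}$-tableaux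 of shape $\lambda$; it is stable under the $\widetilde B_i$ and carries the restricted structure. For every $T$ some $K_1^r(T)$, $r\ge0$, is an $\mathrm{AI}$-tableau, and $P^{\mathrm{AI}}(T):=K_1^r(T)$ with $r\ge0$ minimal with this property. *)

(* Defs.v *)
From mathcomp Require Import all_boot.
From mathcomp Require Import boolp.

Set Implicit Arguments.
Unset Strict Implicit.
Unset Printing Implicit Defensive.

(** Letters are natural numbers (the alphabet is {1, ..., n}), words are
    sequences of letters, a column is the increasing sequence of its entries
    read from top to bottom, and a tableau is the sequence of its nonempty rows
    from top to bottom (English notation).  Rows, columns and positions are
    numbered from 0; the operators [phi i], [eps i], ... carry the original
    index i, 1 <= i <= n - 1. *)

Definition word := seq nat.
Definition tableau := seq (seq nat).

Definition Par (l : nat) (lam : seq nat) : bool :=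
  [&& sorted geq lam, all (ltn 0) lam & size lam <= l].

Definition shape (T : tableau) : seq nat := [seq size r | r <- T].

Definition column (T : tableau) (j : nat) : seq nat :=
  [seq nth 0 r j | r <- T & j < size r].

Definition columns (T : tableau) : seq (seq nat) :=
  [seq column T j | j <- iota 0 (size (head [::] T))].

(** Meaningful when [lam] is a partition. *)
Definition SST (n : nat) (lam : seq nat) (T : tableau) : bool :=
  [&& shape T == lam,
      all (all (fun x => 1 <= x <= n)) T,
      all (sorted leq) T
    & all (sorted ltn) (columns T)].

Definition colword (C : seq nat) : word := rev C.

Definition CR (T : tableau) : word := flatten [seq colword C | C <- columns T].

(** The filling with the shape of [T] whose column reading is [w], for a word
    [w] with as many letters as [T] has cells. *)
Definition with_CR (T : tableau) (w : word) : tableau :=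
  let cols := [seq rev c | c <- reshape [seq size C | C <- columns T] w] in
  [seq [seq nth 0 C i | C <- cols & i < size C] | i <- iota 0 (size T)].

Fixpoint row_insert (T : tableau) (x : nat) : tableau :=
  if T is r :: T' then
    let k := find (ltn x) r in
    if k < size r then set_nth 0 r k x :: row_insert T' (nth 0 r k)
    else rcons r x :: T'
  else [:: [:: x]].

Definition Psymbol (w : word) : tableau := foldl row_insert [::] w.

(** A letter is tagged with its position: [p.1] is the letter, [p.2] the
    position.  [s] is the remaining part of the letters scanned so far, last
    one first. *)
Definition scan_step (i : nat) (s : seq (nat * nat)) (p : nat * nat) :=
  if s is q :: s' then
    if (q.1 == i.+1) && (p.1 == i) then s' else p :: s
  else [:: p].

(** The letters of [w] left, in order, after all deletions.  The deletions are
    performed in one particular order; the outcome does not depend on it. *)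
Definition undeleted (i : nat) (w : word) : seq (nat * nat) :=
  rev (foldl (scan_step i) [::]
    [seq p <- zip w (iota 0 (size w)) | (p.1 == i) || (p.1 == i.+1)]).

(** Positions of the undeleted letters equal to [a], in increasing order. *)
Definition undeleted_pos (i a : nat) (w : word) : seq nat :=
  [seq p.2 | p <- undeleted i w & p.1 == a].

Definition phi_word (i : nat) (w : word) : nat := size (undeleted_pos i i w).
Definition eps_word (i : nat) (w : word) : nat := size (undeleted_pos i i.+1 w).

(** The zero element is [None]. *)
Definition F_word (i : nat) (w : word) : option word :=
  if undeleted_pos i i w is k :: ks
  then Some (set_nth 0 w (last k ks) i.+1) else None.

Definition E_word (i : nat) (w : word) : option word :=
  if undeleted_pos i i.+1 w is k :: _
  then Some (set_nth 0 w k i) else None.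

Definition phi (i : nat) (T : tableau) : nat := phi_word i (CR T).
Definition eps (i : nat) (T : tableau) : nat := eps_word i (CR T).

Definition Etilde (i : nat) (T : tableau) : option tableau :=
  omap (with_CR T) (E_word i (CR T)).
Definition Ftilde (i : nat) (T : tableau) : option tableau :=
  omap (with_CR T) (F_word i (CR T)).

Definition deg (i : nat) (T : tableau) : nat :=
  if odd (phi i T) then (eps i T).+1 else eps i T.

Definition Btilde (i : nat) (T : tableau) : option tableau :=
  if odd (phi i T) then Ftilde i T else Etilde i T.

Definition Kcol (n : nat) (C : seq nat) : seq nat :=
  [seq x <- iota 1 n | x \notin C].

(** Total: a missing first column is read as the empty column. *)
Definition K1 (n : nat) (T : tableau) : tableau :=
  let cs := columns T in
  Psymbol (flatten [seq colword C | C <- Kcol n (head [::] cs) :: behead cs]).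

Definition is_AI (n : nat) (T : tableau) : bool :=
  let C1 := column T 0 in
  let C2 := column T 1 in
  (size C1 <= n./2) &&
  all (fun i => nth 0 (Kcol n C1) i <= nth 0 C2 i) (iota 0 (size C2)).

Definition SST_AI (n : nat) (lam : seq nat) (T : tableau) : bool :=
  SST n lam T && is_AI n T.

(** [iter r (K1 n) T] for the least [r] that makes it an AI-tableau.  If there
    were no such [r], the value would be [T], which is then not an AI-tableau;
    hence [is_AI n (PAI n T)] is equivalent to the existence of such an [r]. *)
Definition PAI (n : nat) (T : tableau) : tableau :=
  match pselect (exists r, is_AI n (iter r (K1 n) T)) with
  | left ex_r => iter (ex_minn ex_r) (K1 n) T
  | right _ => T
  end.

(* Main.v *)
Require Import Defs.
From mathcomp Require Import all_boot.
From mathcomp Require Import boolp zify.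

(** Robinson-Schensted insertion intertwines the crystal operators: they respect
    Knuth equivalence (by the tensor product rule this is a check on three
    letters), Knuth equivalent words have the same P-symbol, and a word is Knuth
    equivalent to the column reading of its P-symbol.  On words, complementing
    the first column exchanges the letters [i] and [i+1] in that column when
    exactly one occurs; then either [phi_i] changes by two, or it
    switches between 0 and 1 while [eps_i] changes by one the other way.  The
    parity rule defining [deg_i] and [B_i] is insensitive to both, so [K_1]
    commutes with every [B_i].  Finally [T] is an AI-tableau iff [d_1 <= m] and
    [K_1 T] has exactly [n - d_1] rows, a condition on shapes only, hence
    invariant under [B_i]; so the least exponent [r] is the same for [T] and
    [B_i T].  Such an [r] exists because, for a [T] which is not an AI-tableau,
    [K_1 T] or [K_1 (K_1 T)] has fewer cells than [T]. *)

Set Implicit Arguments.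
Unset Strict Implicit.
Unset Printing Implicit Defensive.

(** * Signatures and the tensor product rule *)

Section Signature.

Variable i : nat.
Implicit Types (u v w : word) (x : nat).

Notation posI w := (undeleted_pos i i w).
Notation posS w := (undeleted_pos i i.+1 w).

(** The reduced form [i^a (i+1)^b] with each letter tagged by its position: [s] holds the positions
    of the undeleted [i], [t] those of the undeleted [i.+1]. *)
Definition signature_word (s t : seq nat) : seq (nat * nat) :=
  map (pair i) s ++ map (pair i.+1) t.

Lemma signature_word_posI s t :
  [seq p.2 | p <- signature_word s t & p.1 == i] = s.
Proof.
rewrite filter_cat !filter_map (eq_filter (a2 := predT)); last by move=> k /=; lia.
rewrite filter_predT (eq_filter (a2 := pred0)); last by move=> k /=; lia.
by rewrite filter_pred0 cats0 -map_comp map_id.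
Qed.

Lemma signature_word_posS s t :
  [seq p.2 | p <- signature_word s t & p.1 == i.+1] = t.
Proof.
rewrite filter_cat !filter_map (eq_filter (a2 := pred0)); last by move=> k /=; lia.
rewrite filter_pred0 (eq_filter (a2 := predT)); last by move=> k /=; lia.
by rewrite filter_predT /= -map_comp map_id.
Qed.

(** The scan works as a stack: a new [i] cancels the last undeleted [i.+1], and survives only if
    there is none; a new [i.+1] always survives for the moment. *)
Lemma undeleted_rcons w x s t : undeleted i w = signature_word s t ->
  undeleted i (rcons w x) =
    if x == i then
      if t is [::] then signature_word (rcons s (size w)) [::]
      else signature_word s (take (size t).-1 t)
    else if x == i.+1 then signature_word s (rcons t (size w))
    else signature_word s t.
Proof.
have -> : undeleted i (rcons w x) =
    if (x == i) || (x == i.+1)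
    then rev (scan_step i (rev (undeleted i w)) (x, size w))
    else undeleted i w.
  rewrite /undeleted size_rcons -[in iota _ _]addn1 iotaD cats1 zip_rcons ?size_iota //.
  by rewrite filter_rcons /=; case: ifP => // _; rewrite foldl_rcons revK.
move=> ->; have [->|xi] := eqVneq x i; last first.
  have [->|//] := eqVneq x i.+1.
  rewrite /signature_word map_rcons -rcons_cat -[RHS]revK rev_rcons.
  congr rev; case: (rev _) => //= q l.
  by rewrite (_ : i.+1 == i = false) ?andbF //; lia.
rewrite /signature_word; case/lastP: t => [|t b].
  rewrite cats0 map_rcons; case/lastP: s => [//|s a]; rewrite map_rcons rev_rcons /=.
  by rewrite (_ : i == i.+1 = false) /= ?rev_cons ?revK ?cats0 //; lia.
rewrite map_rcons -rcons_cat rev_rcons /= !eqxx /= revK.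
by rewrite size_rcons /= -cats1 takel_cat // take_size; case: t.
Qed.

Lemma undeleted_split w : undeleted i w = signature_word (posI w) (posS w).
Proof.
suff [s [t E]] : exists s t, undeleted i w = signature_word s t.
  by rewrite /undeleted_pos E signature_word_posI signature_word_posS.
elim/last_ind: w => [|w x [s [t /undeleted_rcons]]]; first by exists [::], [::].
move/(_ x) => ->; case: ifP => _.
  by case: t => [|b t]; eexists; eexists; reflexivity.
by case: ifP => _; eexists; eexists; reflexivity.
Qed.

Lemma posI_rcons w x : posI (rcons w x) =
  if (x == i) && (size (posS w) == 0) then rcons (posI w) (size w) else posI w.
Proof.
rewrite {1}/undeleted_pos (undeleted_rcons x (undeleted_split w)).
case: (x == i); last by case: ifP; rewrite signature_word_posI.
by case: (posS w) => [|b t]; rewrite signature_word_posI.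
Qed.

Lemma posS_rcons w x : posS (rcons w x) =
  if x == i then take (size (posS w)).-1 (posS w)
  else if x == i.+1 then rcons (posS w) (size w) else posS w.
Proof.
rewrite {1}/undeleted_pos (undeleted_rcons x (undeleted_split w)).
case: (x == i); last by case: ifP; rewrite signature_word_posS.
by case: (posS w) => [|b t]; rewrite signature_word_posS.
Qed.

Lemma pos_lt w : all (ltn^~ (size w)) (posI w) && all (ltn^~ (size w)) (posS w).
Proof.
have W s m : all (ltn^~ m) s -> all (ltn^~ m.+1) s.
  by apply: sub_all => x /= /ltnW.
elim/last_ind: w => [//|w x /andP[/W hI /W hS]].
rewrite posI_rcons posS_rcons size_rcons; apply/andP; split.
  by case: ifP => // _; rewrite all_rcons hI /= ltnSn.
case: ifP => _; first by apply/allP => y /mem_take; apply: (allP hS).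
by case: ifP => // _; rewrite all_rcons hS /= ltnSn.
Qed.

(** The tensor product rule for positions: the leftmost undeleted [i] of [v] cancel against the
    rightmost undeleted [i.+1] of [u], as many as possible, and everything else stays. *)
Lemma pos_cat u v :
  posI (u ++ v) =
    posI u ++ [seq size u + p | p <- drop (size (posS u)) (posI v)] /\
  posS (u ++ v) =
    take (size (posS u) - size (posI v)) (posS u) ++ [seq size u + p | p <- posS v].
Proof.
elim/last_ind: v => [|v x [IHI IHS]].
  by rewrite !cats0 subn0 take_size.
rewrite -rcons_cat !posI_rcons !posS_rcons IHI IHS size_cat.
have sz : size (take (size (posS u) - size (posI v)) (posS u)) =
    size (posS u) - size (posI v) by rewrite size_takel // leq_subr.
rewrite size_cat sz size_map.
set b := size (posS u) in sz *; set a := size (posI v) in sz *; set c := size (posS v).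
have [xi|xi] /= := eqVneq x i; last first.
  by split => //; case: ifP => _; rewrite ?map_rcons ?rcons_cat.
(* A new [i] first cancels an undeleted [i.+1] of [v]; only when [v] has none does it reach those of
   [u]. *)
have [c0|c0] := eqVneq c 0; last first.
  rewrite addn_eq0 (negPf c0) andbF; split => //.
  rewrite take_cat sz ifF ?map_take; first congr (_ ++ take _ _).
    by move: (b - a) c c0 => d [] //= e _; rewrite addnS /= addKn.
  by move: (b - a) c c0 => d [] //= e _; rewrite addnS /= ltnNge leq_addr.
rewrite c0 addn0 (size0nil c0) /= cats0; split.
  have [ba|ba] := leqP b a.
    rewrite (_ : (b - a == 0)) ?drop_rcons //.
    by rewrite map_rcons rcons_cat.
  rewrite ifF; last by lia.
  by rewrite !drop_oversize ?size_rcons //; exact: ltnW.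
by rewrite cats0 take_takel; [congr take|]; rewrite ?size_rcons; lia.
Qed.

Lemma phi_word_cat u v :
  phi_word i (u ++ v) = phi_word i u + (phi_word i v - eps_word i u).
Proof. by rewrite /phi_word (pos_cat u v).1 size_cat size_map size_drop. Qed.

Lemma eps_word_cat u v :
  eps_word i (u ++ v) = eps_word i v + (eps_word i u - phi_word i v).
Proof.
by rewrite /eps_word (pos_cat u v).2 size_cat size_map size_takel ?leq_subr // addnC.
Qed.

Lemma set_nth_catl u v k x :
  k < size u -> set_nth 0 (u ++ v) k x = set_nth 0 u k x ++ v.
Proof. by elim: u k => [|y u IHu] [|k] //= h; rewrite IHu. Qed.

Lemma set_nth_catr u v k x :
  set_nth 0 (u ++ v) (size u + k) x = u ++ set_nth 0 v k x.
Proof. by elim: u => [|y u IHu] //=; rewrite IHu. Qed.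

Lemma F_wordE w : F_word i w =
  if phi_word i w == 0 then None else Some (set_nth 0 w (last 0 (posI w)) i.+1).
Proof. by rewrite /F_word /phi_word; case: (posI w). Qed.

Lemma E_wordE w : E_word i w =
  if eps_word i w == 0 then None else Some (set_nth 0 w (head 0 (posS w)) i).
Proof. by rewrite /E_word /eps_word; case: (posS w). Qed.

(** The rightmost undeleted [i] of the product lies in [v] exactly when [v] has more undeleted [i]
    than [u] has [i.+1] to cancel them. *)
Lemma F_word_cat u v : F_word i (u ++ v) =
  if eps_word i u < phi_word i v then omap (cat u) (F_word i v)
  else omap (cat^~ v) (F_word i u).
Proof.
rewrite !F_wordE phi_word_cat (pos_cat u v).1.
have [h|h] := ltnP (eps_word i u) (phi_word i v).
  rewrite ifF ?[in RHS]ifF /=; try lia.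
  rewrite last_cat -set_nth_catr; congr (Some (set_nth _ _ _ _)).
  rewrite -{2}(cat_take_drop (size (posS u)) (posI v)) last_cat.
  move: h; rewrite /eps_word /phi_word -subn_gt0 -size_drop.
  by case: drop => //= y s _; rewrite last_map.
rewrite (_ : phi_word i v - _ = 0) ?addn0; last by lia.
case: ifP => //= h'; rewrite drop_oversize ?cats0 //.
rewrite set_nth_catl //.
have := pos_lt u; rewrite /phi_word in h'; case: (posI u) h' => // y s _.
by case/andP => /allP hI _; apply: hI (mem_last y s).
Qed.

(** Dually, the leftmost undeleted [i.+1] lies in [u] exactly when [u] has more of them than [v] has
    [i] to cancel them. *)
Lemma E_word_cat u v : E_word i (u ++ v) =
  if phi_word i v < eps_word i u then omap (cat^~ v) (E_word i u)
  else omap (cat u) (E_word i v).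
Proof.
rewrite !E_wordE eps_word_cat (pos_cat u v).2.
have [h|h] := ltnP (phi_word i v) (eps_word i u).
  rewrite ifF ?[in RHS]ifF /=; try lia.
  have := pos_lt u; rewrite /eps_word /phi_word in h *.
  case: (posS u) h => //= y s h; rewrite (_ : _ - _ = (size s - size (posI v)).+1) //=; last by lia.
  by case/andP => _ /andP[h' _]; rewrite set_nth_catl.
rewrite (_ : eps_word i u - _ = 0) ?addn0; last by lia.
rewrite take0 /=.
case: ifP => //= h'; rewrite -set_nth_catr /eps_word in h' *.
by case: (posS v) h'.
Qed.

Lemma phi_word1 x : phi_word i [:: x] = (x == i).
Proof. by rewrite /phi_word (posI_rcons [::]) andbT; case: (x == i). Qed.

Lemma eps_word1 x : eps_word i [:: x] = (x == i.+1).
Proof.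
rewrite /eps_word (posS_rcons [::]) /=.
by have [->|_] := eqVneq x i; [rewrite ltn_eqF|case: ifP].
Qed.

Lemma F_word1 x : F_word i [:: x] = if x == i then Some [:: i.+1] else None.
Proof. by rewrite F_wordE phi_word1 (posI_rcons [::]) andbT; case: (x == i). Qed.

Lemma E_word1 x : E_word i [:: x] = if x == i.+1 then Some [:: i] else None.
Proof.
rewrite E_wordE eps_word1 (posS_rcons [::]) /=.
by have [->|_] := eqVneq x i; [rewrite (ltn_eqF (ltnSn i))|case: (x == i.+1)].
Qed.

End Signature.

(** * Knuth equivalence *)

Inductive knuth_step : word -> word -> Prop :=
| KnuthStep1 x y z of x < y & y <= z : knuth_step [:: y; z; x] [:: y; x; z]
| KnuthStep2 x y z of x <= y & y < z : knuth_step [:: x; z; y] [:: z; x; y].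

Inductive knuth : word -> word -> Prop :=
| KnuthRefl w : knuth w w
| KnuthMove u v m m' of knuth_step m m' : knuth (u ++ m ++ v) (u ++ m' ++ v)
| KnuthSym w w' of knuth w w' : knuth w' w
| KnuthTrans w w' w'' of knuth w w' & knuth w' w'' : knuth w w''.

Lemma knuth_inv (A : Type) (f : word -> A) :
    (forall u v m m', knuth_step m m' -> f (u ++ m ++ v) = f (u ++ m' ++ v)) ->
  forall w w', knuth w w' -> f w = f w'.
Proof. by move=> h w w'; elim=> // ? ? ? _ -> _ ->. Qed.

Lemma knuth_cat u v w w' : knuth w w' -> knuth (u ++ w ++ v) (u ++ w' ++ v).
Proof.
elim=> [{}w|u' v' m m' h|{}w {}w' _ h|w1 w2 w3 _ h1 _ h2].
- exact: KnuthRefl.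
- have := KnuthMove (u ++ u') (v' ++ v) h.
  by rewrite -!catA.
- exact: KnuthSym.
- exact: KnuthTrans h1 h2.
Qed.

Lemma knuth_step_knuth m m' : knuth_step m m' -> knuth m m'.
Proof. by move/(KnuthMove [::] [::]); rewrite /= !cats0. Qed.

Lemma knuth_perm w w' : knuth w w' -> perm_eq w w'.
Proof.
elim=> // [u v m m' h|? ? _|? ? ? _ h1 _ h2]; last exact: perm_trans h1 h2.
  rewrite perm_cat2l perm_cat2r.
  case: h => x y z _ _.
    by rewrite perm_cons (perm_catC [:: z] [:: x]).
  by rewrite (perm_catCA [:: x] [:: z] [:: y]).
by rewrite perm_sym.
Qed.

(** * Compatibility of the crystal operators with Knuth equivalence *)

Section KnuthCrystal.

Variable i : nat.

Lemma knuth_step_phi m m' : knuth_step m m' -> phi_word i m = phi_word i m'.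
Proof.
case=> x y z lt_xy lt_yz; rewrite !(phi_word_cat i [:: _] [:: _; _]).
all: rewrite !(phi_word_cat i [:: _] [:: _]) !phi_word1 !eps_word1; lia.
Qed.

Lemma knuth_step_eps m m' : knuth_step m m' -> eps_word i m = eps_word i m'.
Proof.
case=> x y z lt_xy lt_yz; rewrite !(eps_word_cat i [:: _] [:: _; _]).
all: rewrite !(phi_word_cat i [:: _] [:: _]) !(eps_word_cat i [:: _] [:: _]).
all: rewrite !phi_word1 !eps_word1; lia.
Qed.

Lemma knuth_phi w w' : knuth w w' -> phi_word i w = phi_word i w'.
Proof.
apply: knuth_inv => u v m m' h.
by rewrite !phi_word_cat (knuth_step_phi h) (knuth_step_eps h).
Qed.

Lemma knuth_eps w w' : knuth w w' -> eps_word i w = eps_word i w'.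
Proof.
apply: knuth_inv => u v m m' h.
by rewrite !(eps_word_cat, phi_word_cat) (knuth_step_phi h) (knuth_step_eps h).
Qed.

Definition option_knuth (o o' : option word) : Prop :=
  match o, o' with
  | Some w, Some w' => knuth w w'
  | None, None => True
  | _, _ => False
  end.

(** Evaluates the tensor product rule on three letters, splits on every comparison, and closes each
    branch by contradiction, by equality of the two words, or by a single Knuth move in either
    direction. *)
Ltac crystal_step :=
  rewrite ?(phi_word_cat _ [:: _] [:: _]) ?(eps_word_cat _ [:: _] [:: _]);
  rewrite !phi_word1 !eps_word1;
  repeat match goal with |- context [if ?b then _ else _] =>
    let H := fresh in destruct b eqn:H end;
  rewrite ?fun_if //=; try lia;
  repeat match goal with H : (_ == _) = true |- _ => move/eqP: H => H; subst end;
  try exact: KnuthRefl;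
  try (apply: knuth_step_knuth; apply: KnuthStep1; lia);
  try (apply: knuth_step_knuth; apply: KnuthStep2; lia);
  try (apply: KnuthSym; apply: knuth_step_knuth; apply: KnuthStep1; lia);
  try (apply: KnuthSym; apply: knuth_step_knuth; apply: KnuthStep2; lia).

Lemma knuth_step_E m m' : knuth_step m m' ->
  option_knuth (E_word i m) (E_word i m').
Proof.
case=> x y z lt_xy lt_yz; rewrite !(E_word_cat i [:: _] [:: _; _]).
all: rewrite !(E_word_cat i [:: _] [:: _]) !E_word1.
all: crystal_step.
(* The case left is [i+1, i+1, i] against [i+1, i, i+1]: the results [i, i+1, i] and [i+1, i, i] are
   related by the other kind of move. *)
have xi : x = i by lia.
by rewrite xi; apply/knuth_step_knuth/KnuthStep2.
Qed.

Lemma knuth_step_F m m' : knuth_step m m' ->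
  option_knuth (F_word i m) (F_word i m').
Proof.
case=> x y z lt_xy lt_yz; rewrite !(F_word_cat i [:: _] [:: _; _]).
all: rewrite !(F_word_cat i [:: _] [:: _]) !F_word1.
all: crystal_step.
(* The mirror case, [i, i+1, i] against [i+1, i, i]: again the kind of move changes. *)
have zi : z = i.+1 by lia.
by rewrite zi; apply/knuth_step_knuth/KnuthStep1.
Qed.

Lemma option_knuth_cat u v o o' : option_knuth o o' ->
  option_knuth (omap (cat u) (omap (cat^~ v) o)) (omap (cat u) (omap (cat^~ v) o')).
Proof. by case: o o' => [w|] [w'|] //=; apply: knuth_cat. Qed.

Lemma option_knuth_refl o : option_knuth o o.
Proof. by case: o => //= w; apply: KnuthRefl. Qed.

Lemma option_knuth_equiv (f : word -> option word) :
    (forall u v m m', knuth_step m m' ->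
       option_knuth (f (u ++ m ++ v)) (f (u ++ m' ++ v))) ->
  forall w w', knuth w w' -> option_knuth (f w) (f w').
Proof.
move=> h w w'; elim=> [{}w|u v m m' /h //|{}w {}w' _|w1 w2 w3 _ h1 _ h2].
- exact: option_knuth_refl.
- by case: (f w) (f w') => [?|] [?|] //=; apply: KnuthSym.
- case: (f w1) (f w2) (f w3) h1 h2 => [?|] [?|] [?|] //=; exact: KnuthTrans.
Qed.

Lemma knuth_E w w' : knuth w w' -> option_knuth (E_word i w) (E_word i w').
Proof.
apply: option_knuth_equiv => u v m m' h.
rewrite !E_word_cat !phi_word_cat (knuth_step_phi h) (knuth_step_eps h).
case: ifP => _.
  by case: (E_word i u) => //= u'; apply/KnuthMove.
case: ifP => _; first exact/option_knuth_cat/knuth_step_E.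
by case: (E_word i v) => //= v'; apply/KnuthMove.
Qed.

Lemma knuth_F w w' : knuth w w' -> option_knuth (F_word i w) (F_word i w').
Proof.
apply: option_knuth_equiv => u v m m' h.
rewrite !F_word_cat !phi_word_cat (knuth_step_phi h) (knuth_step_eps h).
case: ifP => _.
  case: ifP => _; last exact/option_knuth_cat/knuth_step_F.
  by case: (F_word i v) => //= v'; apply/KnuthMove.
by case: (F_word i u) => //= u'; apply/KnuthMove.
Qed.

End KnuthCrystal.

(** * Row insertion *)

Section RowInsertion.

Implicit Types (r s w : seq nat) (T : tableau) (x y z : nat).

(** The first component is the new row, the second the word, of length at most
    one, of bumped letters. *)
Fixpoint insert_row r x : seq nat * seq nat :=
  if r is a :: r' then
    if x < a then (x :: r', [:: a])
    else (a :: (insert_row r' x).1, (insert_row r' x).2)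
  else ([:: x], [::]).

Fixpoint insert_row_word r w : seq nat * seq nat :=
  if w is x :: w' then
    let p := insert_row_word (insert_row r x).1 w' in
    (p.1, (insert_row r x).2 ++ p.2)
  else (r, [::]).

Lemma insert_rowP r x :
  (all (leq^~ x) r /\ insert_row r x = (rcons r x, [::])) \/
  exists r1 y r2, [/\ r = r1 ++ y :: r2, all (leq^~ x) r1, x < y
                    & insert_row r x = (r1 ++ x :: r2, [:: y])].
Proof.
elim: r => [|a r IHr] /=; first by left.
case: ltnP => ax; first by right; exists [::], a, r.
case: IHr => [[rx ->]|[r1 [y [r2 [-> r1x xy ->]]]]]; first by left.
by right; exists (a :: r1), y, r2; split=> //=; rewrite ax.
Qed.

Lemma row_insert_cons r T x :
  row_insert (r :: T) x =
  (insert_row r x).1 :: foldl row_insert T (insert_row r x).2.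
Proof.
rewrite /=; case: (insert_rowP r x) => [[rx ->]|[r1 [y [r2 [-> r1x xy ->]]]]] /=.
  by rewrite -has_find (eq_has (a2 := predC (leq^~ x))) ?has_predC ?rx // => z /=; lia.
have nr1 : has (ltn x) r1 = false.
  by rewrite (eq_has (a2 := predC (leq^~ x))) ?has_predC ?r1x // => z /=; lia.
rewrite find_cat nr1 /= xy addn0 size_cat /= addnS ltnS leq_addr.
by rewrite nth_cat ltnn subnn; have := set_nth_catr r1 (y :: r2) 0 x; rewrite addn0 => ->.
Qed.

Lemma foldl_row_insert_cons r T w :
  foldl row_insert (r :: T) w =
  (insert_row_word r w).1 :: foldl row_insert T (insert_row_word r w).2.
Proof.
elim: w r T => [//|x w IHw] r T.
by rewrite [LHS]/= -/(row_insert (r :: T) x) row_insert_cons IHw /= foldl_cat.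
Qed.

Lemma insert_row_sorted r x : sorted leq r -> sorted leq (insert_row r x).1.
Proof.
case: (insert_rowP r x) => [[rx ->] /= sr|[r1 [y [r2 [-> r1x xy ->]]]] /=].
  by rewrite -cats1 (sorted_pairwise leq_trans) pairwise_cat allrel1r rx
    -(sorted_pairwise leq_trans) sr.
rewrite !(sorted_pairwise leq_trans) !pairwise_cat !allrel_consr /=.
rewrite r1x /= => /andP[/andP[_ ->] /and3P[-> h ->]]; rewrite !andbT.
by apply: sub_all h => t; apply/leq_trans/ltnW.
Qed.

(** The row bumping lemma: every entry up to the new [y] is at most [z], so [z] can only bump an
    entry of [r] to the right of the one bumped by [y]. *)
Lemma insert_row_bump_mono r y z : sorted leq r -> y <= z ->
  let p := insert_row r y in let o := (insert_row p.1 z).2 in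
  o = [::] \/ exists y' z', [/\ p.2 = [:: y'], o = [:: z'], y < y' & y' <= z'].
Proof.
move=> sr yz /=.
case: (insert_rowP (insert_row r y).1 z) => [[_ ->]|[s1 [z' [s2 [E s1z zz' ->]]]]].
  by left.
right; case: (insert_rowP r y) E => [[ry ->] /= E|[r1 [y' [r2 [Er r1y yy' ->]]]] /= E].
  have : z' \in rcons r y by rewrite E mem_cat inE eqxx orbT.
  by rewrite mem_rcons inE => /predU1P[|/(allP ry)]; lia.
exists y', z'; split=> //.
have : z' \in r1 ++ y :: r2 by rewrite E mem_cat inE eqxx orbT.
rewrite mem_cat inE => /or3P[/(allP r1y)|/eqP|zr2]; try lia.
move: sr; rewrite Er (sorted_pairwise leq_trans) pairwise_cat /=.
by case/and3P => _ _ /andP[/allP/(_ _ zr2)].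
Qed.

Lemma insert_row_bump r y e : sorted leq r -> e \in r -> y < e ->
  exists2 y', (insert_row r y).2 = [:: y'] & (y' \in r) && (y < y' <= e).
Proof.
move=> sr er ye.
case: (insert_rowP r y) => [[/allP/(_ _ er)]|[r1 [y' [r2 [Er r1y yy' ->]]]]]; first lia.
exists y' => //; rewrite Er mem_cat inE eqxx orbT yy' /=.
move: er; rewrite Er mem_cat inE => /or3P[/(allP r1y)|/eqP ->//|er2]; first lia.
move: sr; rewrite Er (sorted_pairwise leq_trans) pairwise_cat /=.
by case/and3P => _ _ /andP[/allP/(_ _ er2)].
Qed.

Lemma mem_insert_row r x : x \in (insert_row r x).1.
Proof.
by elim: r => [|a r IHr] /=; [|case: ifP => _ /=]; rewrite inE ?eqxx ?IHr ?orbT.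
Qed.

Lemma insert_row_ge a r x : all (leq a) r -> a <= x -> all (leq a) (insert_row r x).1.
Proof.
move=> + ax; elim: r => [|b r IHr] /=; first by rewrite ax.
by case/andP => ab ar; case: ifP => _ /=; rewrite ?ax ?ar ?ab ?IHr.
Qed.

(** A first entry that is at most every inserted letter never moves, so inductions on the row may
    discard it. *)
Lemma insert_row_word_ge a r w : all (leq a) w ->
  insert_row_word (a :: r) w =
  (a :: (insert_row_word r w).1, (insert_row_word r w).2).
Proof.
by elim: w r => [//|x w IHw] r /= /andP[ax aw]; rewrite ltnNge ax /= IHw.
Qed.

(** Induction on the row. If the smallest letter [x] is at least the first entry [a], that entry is
    inert. Otherwise [x] is less than [a], and the bumped words can be compared explicitly according
    to where the larger letters go. *)
Lemma knuth_step_insert_row r m m' : sorted leq r -> knuth_step m m' ->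
  (insert_row_word r m).1 = (insert_row_word r m').1 /\
  ((insert_row_word r m).2 = (insert_row_word r m').2 \/
   knuth_step (insert_row_word r m).2 (insert_row_word r m').2).
Proof.
move=> + st; elim: r => [|a r IHr] sr.
  by case: st => x y z xy yz /=; repeat (case: ltnP => ? //=; try lia);
    split=> //; left.
have ar : all (leq a) r by apply: order_path_min sr; apply: leq_trans.
have {IHr} := IHr (path_sorted sr); have {}sr := path_sorted sr.
case: st => x y z xy yz.
  have [xa|ax] := ltnP x a; last first.
    by rewrite !insert_row_word_ge /=; try lia; case=> -> h; split.
  (* If [y < a], the bumped words are [a z' y] and [a y z'] with [y < a <= z']. If [a <= y], they
     are [y' z' a] and [y' a z'] with [a < y' <= z']. They coincide when [z] bumps nothing. *)
  have [ya|ay] := ltnP y a.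
    have [zy zx] : (z < y = false) /\ (z < x = false) by lia.
    move=> _; rewrite /= ya /= zy /= xy /= zx /=.
    split=> //; case: (insert_rowP r z) => [[_ ->]|]; first by left.
    move=> [r1 [z' [r2 [Er _ _ ->]]]]; right; apply: KnuthStep1 => //=.
    by apply: (allP ar); rewrite Er mem_cat inE eqxx orbT.
  move=> _; have [yF zF] : (y < a = false) /\ (z < a = false) by lia.
  have zx : z < x = false by lia.
  rewrite /= yF /= zF /= xa /= zx /=; split=> //.
  have := insert_row_bump_mono sr yz; rewrite /=.
  case=> [->|[y' [z' [-> -> yy' yz']]]]; first by left; rewrite cats0.
  by right; apply: KnuthStep1 => //; lia.
have [xa|ax] := ltnP x a; last first.
  by rewrite !insert_row_word_ge /=; try lia; case=> -> h; split.
have [yx zx] : (y < x = false) /\ (z < x = false) by lia.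
(* If [a <= z], the bumped words are [a z' y'] and [z' a y']; here [y' <= z < z'] because [z]
   already stands in the row when [y] arrives. *)
have [za|az] := ltnP z a; last first.
  have zF : z < a = false by lia.
  move=> _; rewrite /= xa /= zx /= yx /= zF /= xa /= yx /=; split=> //.
  case: (insert_rowP r z) => [[_ ->]|]; first by left.
  move=> [r1 [z' [r2 [Er r1z zz' Ez]]]].
  have [] := insert_row_bump (insert_row_sorted z sr) (mem_insert_row r z) yz.
  move=> y' -> /andP[y'r /andP[yy' y'z]]; rewrite Ez /=; right.
  apply: KnuthStep2; last lia.
  exact: (allP (insert_row_ge ar az)) y'r.
move=> _; rewrite /= xa /= zx /= yx /= za /= (leq_ltn_trans xy yz) /= yx /=.
(* Now [z < a], so [z] and [y] both hit the first entry [b] of the tail: the bumped words are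
   [a b z] and [a z b] with [z < a <= b], a move of the first kind. *)
have bump s : all (leq a) s -> insert_row s z = (z :: behead s, take 1 s).
  by case: s => [//|b s] /andP[ab _] /=; rewrite (leq_trans za ab) take0.
rewrite (bump r ar) /= yz /=; split.
  congr cons; case: r ar {sr} => [|b r] //= /andP[ab _].
  by rewrite (_ : y < b) //; lia.
case: r ar {sr} => [|b r] /=; [by left | case/andP=> ab _].
rewrite (_ : y < b) /=; last by lia.
by right; rewrite take0; apply: KnuthStep1.
Qed.

End RowInsertion.

Lemma knuth_step_row_insert T m m' : all (sorted leq) T -> knuth_step m m' ->
  foldl row_insert T m = foldl row_insert T m'.
Proof.
elim: T m m' => [|r T IHT] m m'.
  move=> _ [] x y z xy yz.
    have [zy zx] : (z < y = false) /\ (z < x = false) by lia.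
    by rewrite /= zy /= xy /= zx.
  have [zx yx] : (z < x = false) /\ (y < x = false) by lia.
  by rewrite /= zx /= yx /= yz /= (leq_ltn_trans xy yz) /= yx.
case/andP=> sr sT st; rewrite !foldl_row_insert_cons.
by have [-> [->//|/IHT ->]] := knuth_step_insert_row sr st.
Qed.

Lemma row_insert_sorted T x : all (sorted leq) T -> all (sorted leq) (row_insert T x).
Proof.
elim: T x => [|r T IHT] x //; rewrite row_insert_cons [all _ (r :: T)]/=.
case/andP => sr sT; rewrite /= insert_row_sorted //=.
by case: (insert_rowP r x) => [[_ ->]|[r1 [y [r2 [_ _ _ ->]]]]] //=; exact: IHT.
Qed.

Lemma foldl_row_insert_sorted T w :
  all (sorted leq) T -> all (sorted leq) (foldl row_insert T w).
Proof. by elim: w T => [//|x w IHw] T sT; apply/IHw/row_insert_sorted. Qed.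

Lemma knuth_Psymbol w w' : knuth w w' -> Psymbol w = Psymbol w'.
Proof.
apply: knuth_inv => u v m m' h; rewrite /Psymbol !foldl_cat.
by rewrite (knuth_step_row_insert _ h) // foldl_row_insert_sorted.
Qed.

Definition row_reading T : word := flatten (rev T).

Lemma row_reading_cons r T : row_reading (r :: T) = row_reading T ++ r.
Proof. by rewrite /row_reading rev_cons flatten_rcons. Qed.

(** The letter [x] travels left past the larger entries by moves of the first kind, down to its
    place; the bumped entry then travels left past the smaller ones by moves of the second kind. *)
Lemma knuth_insert_row r x : sorted leq r ->
  knuth (rcons r x) ((insert_row r x).2 ++ (insert_row r x).1).
Proof.
elim: r => [|a r IHr] sr; first exact: KnuthRefl.
have ar : all (leq a) r by apply: order_path_min sr; apply: leq_trans.
have {}sr := path_sorted sr; rewrite /=; case: ltnP => ax.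
  elim/last_ind: r ar sr {IHr} => [|r b IHr] /=; first by move=> _ _; apply: KnuthRefl.
  rewrite all_rcons => /andP[ab ar] sr.
  have {IHr} := IHr ar _; have -> : sorted leq r.
    by move: sr; rewrite -cats1 => /cat_sorted2[].
  move=> /(_ isT) /(knuth_cat [::] [:: b]) /= h.
  rewrite -!cats1 -!catA /=; apply: KnuthTrans (h); rewrite -cats1 -!catA /=.
  have := sr; case/lastP: r ar {h sr} => [|r c] ar sr.
    by apply/knuth_step_knuth/KnuthStep1.
  have cb : c <= b.
    by move: sr; rewrite -2!cats1 -catA => /cat_sorted2[_] /= /andP[].
  have ac : a <= c by move: ar; rewrite all_rcons => /andP[].
  have xc : x < c by lia.
  by rewrite -cats1 -!catA /=; exact: (KnuthMove (a :: r) [::] (KnuthStep1 xc cb)).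
have := IHr sr; case: (insert_rowP r x) => [[_ ->] _|]; first exact: KnuthRefl.
move=> [r1 [y [r2 [Er r1x xy ->]]]] /= /(knuth_cat [:: a] [::]).
rewrite !cats0 /= => /KnuthTrans; apply.
(* A move needs three letters: [c], the entry following [a] in the new row, is the witness that lets
   [a] and [y] change places. *)
have [c [s [-> ac cy]]] : exists c s, [/\ r1 ++ x :: r2 = c :: s, a <= c & c < y].
  case: r1 r1x Er => [|c r1] /=; first by move=> _ _; exists x, r2.
  move=> /andP[cx _] Er; exists c, (r1 ++ x :: r2); split=> //; last lia.
  by move: ar; rewrite Er /= => /andP[].
by apply: (KnuthMove [::] s (KnuthStep2 ac cy)).
Qed.

Lemma knuth_row_insert T x : all (sorted leq) T ->
  knuth (rcons (row_reading T) x) (row_reading (row_insert T x)).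
Proof.
elim: T x => [|r T IHT] x; first by move=> _; apply: KnuthRefl.
rewrite row_insert_cons row_reading_cons => /andP[sr sT].
have := knuth_insert_row x sr; rewrite row_reading_cons rcons_cat.
move/(knuth_cat (row_reading T) [::]); rewrite !cats0 => /KnuthTrans; apply.
case: (insert_rowP r x) => [[_ ->]|[r1 [y [r2 [_ _ _ ->]]]]] /=.
  exact: KnuthRefl.
have := knuth_cat [::] (r1 ++ x :: r2) (IHT y sT).
by rewrite -cats1 -catA.
Qed.

Lemma knuth_row_reading w : knuth w (row_reading (Psymbol w)).
Proof.
elim/last_ind: w => [|w x IHw]; first exact: KnuthRefl.
rewrite /Psymbol foldl_rcons; apply: KnuthTrans; last first.
  exact/knuth_row_insert/foldl_row_insert_sorted.
by rewrite -!cats1; have := knuth_cat [::] [:: x] IHw.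
Qed.

(** * Semistandard fillings and their columns *)

Implicit Types (r s t C : seq nat) (w : word) (T X cs : seq (seq nat)).

(** With [ltn] this is the condition between consecutive rows of a tableau, with [leq] the one
    between consecutive columns. *)
Fixpoint dominates (e : rel nat) s t : bool :=
  match s, t with
  | _, [::] => true
  | a :: s', b :: t' => e a b && dominates e s' t'
  | [::], _ => false
  end.

Lemma dominatesP (e : rel nat) s t :
  reflect (size t <= size s /\ forall k, k < size t -> e (nth 0 s k) (nth 0 t k))
          (dominates e s t).
Proof.
elim: s t => [|a s IHs] [|b t]; try by constructor.
  by constructor; case.
apply: (iffP andP) => [[ab /IHs[le_ts h]]|[le_ts h]].
  by split=> // -[|k] //=; apply: h.
by split; [apply: (h 0) | apply/IHs; split=> // k; apply: (h k.+1)].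
Qed.

Lemma dominates_leq_trans : transitive (dominates leq).
Proof.
move=> t s u /dominatesP[st hst] /dominatesP[tu htu]; apply/dominatesP.
split=> [|k ku]; first exact: leq_trans tu st.
exact: leq_trans (hst _ (leq_trans ku tu)) (htu _ ku).
Qed.

Lemma path_dominates (e : rel nat) s X :
  path (dominates e) s X = dominates e s (head [::] X) && sorted (dominates e) X.
Proof. by case: X => //=; case: s. Qed.

(** * Transposition of fillings *)

Section Transpose.

Definition decreasing X := sorted geq (Defs.shape X).

Lemma decreasingP X :
  reflect (forall i, size (nth [::] X i.+1) <= size (nth [::] X i)) (decreasing X).
Proof.
apply: (iffP (sortedP 0)) => h i.
  have [iX|iX] := ltnP i.+1 (size X); last by rewrite nth_default.
  have := h i; rewrite size_map => /(_ iX).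
  by rewrite !(nth_map [::]) //; apply: ltnW.
by rewrite size_map => iX; rewrite !(nth_map [::]) //; [apply: h | apply: ltnW].
Qed.

Lemma sorted_dominates_decreasing (e : rel nat) X :
  sorted (dominates e) X -> decreasing X.
Proof.
rewrite /decreasing sorted_map.
by apply: sub_sorted => s t /dominatesP[].
Qed.

Lemma column_cons r X j :
  column (r :: X) j = if j < size r then nth 0 r j :: column X j else column X j.
Proof. by rewrite /column /=; case: ifP. Qed.

Lemma column_nil r X j : decreasing (r :: X) -> size r <= j -> column X j = [::].
Proof.
rewrite /decreasing /= => /(order_path_min (rev_trans leq_trans)) rX rj.
rewrite /column (eq_in_filter (a2 := pred0)) ?filter_pred0 // => s sX.
by move/allP: rX => /(_ _ (map_f size sX)) /= sr; rewrite ltnNge (leq_trans sr rj).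
Qed.

(** Both sides say that [(i, j)] is a cell of the diagram. *)
Lemma size_column X i j : decreasing X ->
  (i < size (column X j)) = (j < size (nth [::] X i)).
Proof.
elim: X i => [|r X IHX] i dX; first by rewrite nth_nil.
have dX' : decreasing X := path_sorted dX.
rewrite column_cons; have [jr|rj] := ltnP j (size r).
  by case: i => [|i] /=; rewrite ?jr // ltnS IHX.
have cX := column_nil dX rj; rewrite cX.
case: i => [|i] /=; first by apply/esym/negbTE; rewrite -leqNgt.
by rewrite -IHX // cX.
Qed.

Lemma nth_column X i j : decreasing X ->
  nth 0 (column X j) i = nth 0 (nth [::] X i) j.
Proof.
elim: X i => [|r X IHX] i dX; first by rewrite !nth_nil.
have dX' : decreasing X := path_sorted dX.
rewrite column_cons; have [jr|rj] := ltnP j (size r).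
  by case: i => [|i] //=; rewrite IHX.
have cX := column_nil dX rj; rewrite cX nth_nil.
case: i => [|i] /=; first by rewrite nth_default.
by rewrite -IHX // cX nth_nil.
Qed.

Lemma size_columns X : size (columns X) = size (head [::] X).
Proof. by rewrite size_map size_iota. Qed.

Lemma nth_columns X j : decreasing X -> nth [::] (columns X) j = column X j.
Proof.
move=> dX; have [jX|jX] := ltnP j (size (head [::] X)).
  by rewrite (nth_map 0) ?size_iota // nth_iota.
rewrite nth_default ?size_columns //; case: X dX jX => [//|r X] dX /= rj.
by rewrite column_cons ltnNge rj /= (column_nil dX).
Qed.

Lemma decreasing_columns X : decreasing X -> decreasing (columns X).
Proof.
move=> dX; apply/decreasingP => j; rewrite !nth_columns // leqNgt size_column //.
by rewrite -leqNgt leqW // leqNgt -size_column // ltnn.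
Qed.

Lemma columns_gt0 X : decreasing X -> all (ltn 0) (Defs.shape (columns X)).
Proof.
move=> dX; rewrite all_map; apply/allP => s /(nthP [::]) [j jX <-] /=.
by rewrite nth_columns // size_column // nth0 -size_columns.
Qed.

Lemma eq_filling X Y : decreasing X -> decreasing Y ->
    all (ltn 0) (Defs.shape X) -> all (ltn 0) (Defs.shape Y) ->
    (forall i j, (j < size (nth [::] X i)) = (j < size (nth [::] Y i))) ->
    (forall i j, nth 0 (nth [::] X i) j = nth 0 (nth [::] Y i) j) ->
  X = Y.
Proof.
move=> dX dY pX pY sz ent.
have szXY i : size (nth [::] X i) = size (nth [::] Y i).
  by apply/eqP; rewrite eqn_leq [_ <= _]leqNgt sz ltnn leqNgt -sz ltnn.
have szE Z i : all (ltn 0) (Defs.shape Z) -> (i < size Z) = (0 < size (nth [::] Z i)).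
  move=> pZ; have [iZ|iZ] := ltnP; last by rewrite nth_default.
  by move: pZ; rewrite all_map => /(all_nthP [::])/(_ _ iZ) /= ->.
apply: (@eq_from_nth _ [::]) => [|i _].
  by apply/eqP; rewrite eqn_leq [_ <= _]leqNgt szE // sz -szE // ltnn leqNgt szE // -sz -szE // ltnn.
by apply: (@eq_from_nth _ 0) => [|j _].
Qed.

Lemma columnsK X : decreasing X -> all (ltn 0) (Defs.shape X) ->
  columns (columns X) = X.
Proof.
move=> dX pX; have dX' := decreasing_columns dX.
apply: eq_filling; rewrite ?columns_gt0 ?decreasing_columns //.
  by move=> i j; rewrite nth_columns // size_column // nth_columns // size_column.
by move=> i j; rewrite nth_columns // nth_column // nth_columns // nth_column.
Qed.

Lemma size_head_columns X : decreasing X -> all (ltn 0) (Defs.shape X) ->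
  size (head [::] (columns X)) = size X.
Proof. by move=> dX pX; rewrite -size_columns columnsK. Qed.

Lemma sorted_dominates (e : rel nat) X : decreasing X ->
  sorted (dominates e) X = all (sorted e) (columns X).
Proof.
move=> dX; apply/(sortedP [::])/(all_nthP [::]) => h i.
  rewrite size_columns nth_columns // => _; apply/(sortedP 0) => k.
  rewrite size_column // !nth_column // => ik.
  have kX : k.+1 < size X by case: (ltnP k.+1 (size X)) ik => // ?; rewrite nth_default.
  by have /dominatesP[_] := h _ kX; apply.
move=> _; apply/dominatesP; split=> [|k ki]; first exact/decreasingP.
rewrite -!nth_column // -nth_columns //; apply: (sortedP 0 _); last first.
  by rewrite nth_columns // size_column.
apply: h; rewrite size_columns; apply: leq_trans ki _.
by rewrite -nth0; elim: i => [|i IHi]; [apply/decreasingP | apply: leq_trans IHi; apply/decreasingP].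
Qed.

End Transpose.

(** Row-wise, a semistandard tableau is a [filling leq ltn]; listing its columns
    turns it into a [filling ltn leq]. *)
Definition filling (e1 e2 : rel nat) (n : nat) X : bool :=
  [&& all (ltn 0) (Defs.shape X), all (all (fun x => 1 <= x <= n)) X,
      all (sorted e1) X & sorted (dominates e2) X].

Lemma filling_decreasing e1 e2 n X : filling e1 e2 n X -> decreasing X.
Proof. by case/and4P => _ _ _ /sorted_dominates_decreasing. Qed.

Lemma filling_columnsK e1 e2 n X : filling e1 e2 n X -> columns (columns X) = X.
Proof. by move=> fX; rewrite columnsK ?(filling_decreasing fX) //; case/and4P: fX. Qed.

Lemma filling_columns e1 e2 n X : filling e1 e2 n X -> filling e2 e1 n (columns X).
Proof.
move=> fX; have dX := filling_decreasing fX; case/and4P: (fX) => pX eX sX dmX.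
apply/and4P; split; first exact: columns_gt0.
- apply/allP => s /mapP[j _ ->]; apply/allP => x /mapP[r].
  rewrite mem_filter => /andP[jr rX] ->.
  by move: (allP (allP eX _ rX)); apply; apply: mem_nth.
- by rewrite -sorted_dominates.
by rewrite sorted_dominates ?decreasing_columns // (filling_columnsK fX).
Qed.

Lemma filling_SST n k T : size T <= k -> filling leq ltn n T ->
  Par k (Defs.shape T) /\ SST n (Defs.shape T) T.
Proof.
move=> Tk fT; have := filling_columns fT; case/and4P: (fT) => pT eT sT _.
case/and4P => _ _ cT _; split; last exact/and4P.
by apply/and3P; split; rewrite ?size_map //; exact: filling_decreasing fT.
Qed.

Lemma SST_filling n k lam T : Par k lam -> SST n lam T -> filling leq ltn n T.
Proof.
move=> /and3P[dT pT _] /and4P[/eqP lE eT sT cT]; subst lam.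
by apply/and4P; split=> //; rewrite sorted_dominates.
Qed.

Lemma column_in_iota n C : all (fun x => 1 <= x <= n) C -> {subset C <= iota 1 n}.
Proof. by move=> h x /(allP h); rewrite mem_iota add1n ltnS. Qed.

Lemma filling_size n T : filling leq ltn n T -> size T <= n.
Proof.
move=> fT; rewrite -size_head_columns ?(filling_decreasing fT) //; last by case/and4P: fT.
have := filling_columns fT; case: (columns T) => [//|C cs].
case/and4P => _ /andP[eC _] /andP[sC _] _ /=; rewrite -(size_iota 1 n).
by apply/uniq_leq_size/column_in_iota => //; apply: sorted_uniq sC; [exact: ltn_trans|exact: ltnn].
Qed.

(** * Row insertion preserves semistandardness *)

Section InsertionTableau.

Lemma dominates_insert_row_l r t x :
  dominates ltn r t -> dominates ltn (insert_row r x).1 t.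
Proof.
elim: r t => [|a r IHr] [|b t] //=; first by case: ifP.
case/andP=> ab rt.
by case: ltnP => ax /=; [rewrite (ltn_trans ax ab)|rewrite ab IHr].
Qed.

(** The entry of [t] below the old place of [y], if any, exceeds [y], so [y] comes to rest weakly to
    the left of that place, where the new upper row has entries at most [x < y]. *)
Lemma dominates_insert_row r t x y : dominates ltn r t -> (insert_row r x).2 = [:: y] ->
  dominates ltn (insert_row r x).1 (insert_row t y).1.
Proof.
elim: r t => [//|a r IHr] t /=; case: ltnP => ax /=.
  move=> rt [<-]; case: t rt => [|b t] /=; first by rewrite ax; case: r {IHr}.
  by case/andP => -> rt /=; rewrite ax.
move=> + rxy; have ay : a < y.
  by case: (insert_rowP r x) rxy => [[_ ->]|[? [z [? [_ _ xz ->]]]]] //= [<-]; lia.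
case: t => [|b t] /=; first by rewrite ay; case: (insert_row r x).1.
case/andP=> ab rt; case: ltnP => yb /=; first by rewrite ay dominates_insert_row_l.
by rewrite ab IHr.
Qed.

Lemma path_row_insert r T x y : path (dominates ltn) r T ->
    (insert_row r x).2 = [:: y] ->
  path (dominates ltn) (insert_row r x).1 (row_insert T y).
Proof.
elim: T r x y => [|t T IHT] r x y.
  move=> _ rxy; have := @dominates_insert_row r [::] x y.
  by case: r rxy => //= a r -> /(_ isT erefl) ->.
case/andP=> rt tT rxy; rewrite row_insert_cons /= dominates_insert_row //=.
case: (insert_rowP t y) (IHT t y) => [[_ E] _|[r1 [z [r2 [_ _ _ ->]]]]] /=; last by apply.
rewrite E /=; move: tT; rewrite -/(path _ t T) !path_dominates => /andP[h ->]; rewrite andbT.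
by have := dominates_insert_row_l y h; rewrite E.
Qed.

Lemma row_insert_all (P : pred nat) T x : all (all P) T -> P x -> all (all P) (row_insert T x).
Proof.
move=> + Px; elim: T x Px => [|r T IHT] x Px; first by rewrite /= Px.
rewrite row_insert_cons => /andP[Pr PT].
case: (insert_rowP r x) => [[_ ->]|[r1 [y [r2 [Er _ _ ->]]]]] /=.
  by rewrite all_rcons Px Pr.
move: Pr; rewrite Er !all_cat /= => /and3P[-> Py ->]; rewrite Px /=.
exact: IHT.
Qed.

Lemma row_insert_gt0 T x : all (ltn 0) (Defs.shape T) ->
  all (ltn 0) (Defs.shape (row_insert T x)).
Proof.
elim: T x => [|r T IHT] x //; rewrite row_insert_cons => /= /andP[r0 T0].
case: (insert_rowP r x) => [[_ ->]|[r1 [y [r2 [_ _ _ ->]]]]] /=; first by rewrite size_rcons.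
by rewrite size_cat addnS /= IHT.
Qed.

Lemma row_insert_filling n T x : filling leq ltn n T -> 1 <= x <= n ->
  filling leq ltn n (row_insert T x).
Proof.
case/and4P=> pT eT sT dT xn.
apply/and4P; split; [exact: row_insert_gt0|exact: row_insert_all|exact: row_insert_sorted|].
case: T dT {pT eT sT} => [//|r T] dT; rewrite row_insert_cons.
have := @path_row_insert r T x; case: (insert_rowP r x) => [[_ E] _|[r1 [y [r2 [_ _ _ ->]]]]] /=.
  move: dT; rewrite /= !path_dominates => /andP[h]; rewrite E /= => ->.
  by have := dominates_insert_row_l x h; rewrite E /= => ->.
exact.
Qed.

Lemma Psymbol_filling n w : all (fun x => 1 <= x <= n) w -> filling leq ltn n (Psymbol w).
Proof.
elim/last_ind: w => [//|w x IHw]; rewrite all_rcons => /andP[xn wn].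
by rewrite /Psymbol foldl_rcons; apply: row_insert_filling (IHw wn) xn.
Qed.

End InsertionTableau.

(** * Insertion of column words and the P-symbol of a column reading *)

Section ColumnInsertion.

Fixpoint append_column T C : tableau :=
  match C, T with
  | [::], _ => T
  | c :: C', [::] => [:: c] :: append_column [::] C'
  | c :: C', r :: T' => rcons r c :: append_column T' C'
  end.

Definition fits T C := forall i y, y \in nth [::] T i -> i < size C -> y <= nth 0 C i.

(** The letter [x] displaces exactly the last entry of the first row, the head of [C], which in turn
    does the same one row further down: the whole new column shifts by one. *)
Lemma row_insert_append_column T C x : path ltn x C -> fits T (x :: C) ->
  row_insert (append_column T C) x = append_column T (x :: C).
Proof.
elim: C T x => [|c C IHC] T x xC fTC.
  case: T fTC => [//|r T] fTC; rewrite row_insert_cons.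
  case: (insert_rowP r x) => [[_ ->]//|[r1 [y [r2 [Er _ xy _]]]]].
  have := fTC 0 y; rewrite /= Er mem_cat inE eqxx orbT; lia.
case/andP: xC => /= xc cC.
case: T fTC => [|r T] fTC /=; first by rewrite xc /= IHC // => i y; rewrite nth_nil.
rewrite -[LHS]/(row_insert (rcons r c :: append_column T C) x) row_insert_cons.
have rx : all (leq^~ x) r by apply/allP => y yr; apply: (fTC 0 y).
have -> : insert_row (rcons r c) x = (rcons r x, [:: c]).
  by elim: r rx {fTC} => [|a r IHr] /=; rewrite ?xc // => /andP[ax /IHr ->]; rewrite ltnNge ax.
by rewrite /= IHC // => i y yT iC; apply: (fTC i.+1).
Qed.

Lemma foldl_row_insert_column T C : sorted ltn C -> fits T C ->
  foldl row_insert T (rev C) = append_column T C.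
Proof.
elim: C => [|x C IHC] sC fTC; first by case: T fTC.
rewrite rev_cons foldl_rcons IHC ?(path_sorted sC) //; first exact: row_insert_append_column.
move=> i y yT iC; apply: leq_trans (fTC i y yT (leqW iC)) _.
have /(sortedP 0) h := sC; apply: ltnW; exact: (h i).
Qed.

Lemma append_column_map (f : nat -> seq nat) k N C : size C <= N ->
  append_column [seq f i | i <- iota k N] C =
  [seq if i - k < size C then rcons (f i) (nth 0 C (i - k)) else f i | i <- iota k N].
Proof.
elim: N k C => [|N IHN] k [|c C] // CN.
rewrite /= IHN // subnn /=; congr cons; apply/eq_in_map => i; rewrite mem_iota => /andP[ki _].
by rewrite -(subnSK ki) /= ltnS.
Qed.

Lemma columns_rcons cs C : sorted (dominates leq) (rcons cs C) ->
  columns (rcons cs C) = append_column (columns cs) C.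
Proof.
case: cs => [_|D cs].
  rewrite /= /columns /=.
  have -> : append_column [::] C = [seq [:: c] | c <- C] by elim: C => //= c C ->.
  rewrite -[in RHS](mkseq_nth 0 C) /mkseq -map_comp; apply/eq_in_map => i.
  by rewrite mem_iota /= /column /= => ->.
move=> /= h; have DC : size C <= size D.
  have := order_path_min dominates_leq_trans h.
  by rewrite all_rcons => /andP[/dominatesP[]].
rewrite /columns /= append_column_map //; apply: eq_map => i; rewrite subn0.
rewrite /column -rcons_cons filter_rcons; case: ifP => // _.
by rewrite map_rcons.
Qed.

Definition reading cs : word := flatten [seq colword C | C <- cs].

(** Each column word is inserted from its largest letter up to its smallest and adds one column at
    the right; [fits] holds because earlier columns dominate later ones. *)
Lemma Psymbol_reading n cs : filling ltn leq n cs -> Psymbol (reading cs) = columns cs.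
Proof.
elim/last_ind: cs => [//|cs C IHcs] f; have d := filling_decreasing f.
case/and4P: (f); rewrite /Defs.shape map_rcons !all_rcons.
move=> /andP[C0 pcs] /andP[eC ecs] /andP[sC scs] dcs.
have dcs' : sorted (dominates leq) cs by move: dcs; rewrite -cats1 => /cat_sorted2[].
have fcs : filling ltn leq n cs by apply/and4P.
rewrite columns_rcons // -(IHcs fcs) /reading map_rcons flatten_rcons /Psymbol foldl_cat.
rewrite foldl_row_insert_column // -/(Psymbol _) -/(reading cs) IHcs //.
move=> i y; rewrite nth_columns ?(filling_decreasing fcs) // => /mapP[D].
rewrite mem_filter => /andP[iD Dcs] -> iC.
move: dcs; rewrite (sorted_pairwise dominates_leq_trans) -cats1 pairwise_cat allrel1r.
by case/andP => /allP/(_ _ Dcs) /dominatesP[_ h] _; apply: h.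
Qed.

Lemma with_CR_reading T cs : size T = size (head [::] cs) ->
    [seq size C | C <- cs] = [seq size C | C <- columns T] ->
  with_CR T (reading cs) = columns cs.
Proof.
move=> sT sz; rewrite /with_CR -sz.
have -> : [seq size C | C <- cs] = seq.shape [seq colword C | C <- cs].
  by rewrite /seq.shape -map_comp; apply: eq_map => C /=; rewrite size_rev.
rewrite flattenK -map_comp (eq_map (g := id)) ?map_id; last by move=> C; apply: revK.
by rewrite sT.
Qed.

End ColumnInsertion.

(** * Crystal operators on column readings *)

Implicit Types (D : seq nat) (u v : word).

Section ColumnCrystal.

Variable i : nat.

(** On a strictly increasing column containing exactly one of [i] and [i.+1], this transposition is
    the action of whichever of the two crystal operators is nonzero. *)
Definition swap (x : nat) := if x == i then i.+1 else if x == i.+1 then i else x.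

Lemma swapK : involutive swap.
Proof. by move=> x; rewrite /swap; do ! case: ifP; lia. Qed.

Lemma mem_map_swap C x : (x \in map swap C) = (swap x \in C).
Proof. by rewrite -{1}(swapK x) mem_map //; apply: inv_inj swapK. Qed.

Lemma swap_i : swap i = i.+1. Proof. by rewrite /swap eqxx. Qed.
Lemma swap_iS : swap i.+1 = i. Proof. by rewrite /swap eqxx; case: eqP; lia. Qed.

Lemma map_swap_id C : i \notin C -> i.+1 \notin C -> map swap C = C.
Proof.
move=> iC sC; apply: map_id_in => x xC; rewrite /swap.
by case: eqP xC iC => [->->//|_ xC _]; case: eqP xC sC => [->->|].
Qed.

Lemma nth_map_swap C k : k < size C -> nth 0 (map swap C) k = swap (nth 0 C k).
Proof. exact: nth_map. Qed.

Lemma sorted_map_swap C : sorted ltn C -> (i \in C) != (i.+1 \in C) ->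
  sorted ltn (map swap C).
Proof.
move=> sC iC; apply: (homo_sorted_in (P := mem C)) sC; last exact/allP.
move=> x y /= xC yC xy; rewrite /swap; do ! case: eqP => ?; subst; try lia.
by rewrite xC yC in iC.
Qed.

Let lt_notin x C : path ltn x C -> forall y, y <= x -> y \notin C.
Proof.
move=> /(order_path_min ltn_trans)/allP h y yx.
by apply/negP => /h /=; lia.
Qed.

(** A column is read in decreasing order, so when both letters occur, [i.+1] comes directly before
    [i] and the two cancel. *)
Lemma phi_eps_column C : sorted ltn C ->
  phi_word i (rev C) = (i \in C) && (i.+1 \notin C) /\
  eps_word i (rev C) = (i.+1 \in C) && (i \notin C).
Proof.
elim: C => [//|x C IHC] /= xC; have [hp he] := IHC (path_sorted xC).
rewrite rev_cons -cats1 phi_word_cat eps_word_cat phi_word1 eps_word1 hp he !inE.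
have := lt_notin xC.
rewrite ![_ == x]eq_sym; case: (eqVneq x i) => [->|xi] h /=.
  by rewrite (negPf (h i _)) // ltn_eqF //=; case: (i.+1 \in C).
case: (eqVneq x i.+1) => [xE|xsi] /=; last by rewrite subn0 addn0.
by rewrite (negPf (h i _)) ?(negPf (h i.+1 _)) //; lia.
Qed.

Lemma phi_column C : sorted ltn C -> phi_word i (rev C) = (i \in C) && (i.+1 \notin C).
Proof. by case/phi_eps_column. Qed.

Lemma eps_column C : sorted ltn C -> eps_word i (rev C) = (i.+1 \in C) && (i \notin C).
Proof. by case/phi_eps_column. Qed.

Lemma F_column C : sorted ltn C -> F_word i (rev C) =
  if (i \in C) && (i.+1 \notin C) then Some (rev (map swap C)) else None.
Proof.
elim: C => [//|x C IHC] /= xC; have sC := path_sorted xC.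
rewrite !rev_cons -!cats1 F_word_cat phi_word1 F_word1 eps_column // IHC // !inE.
have := lt_notin xC.
rewrite ![_ == x]eq_sym; case: (eqVneq x i) => [->|xi] h /=.
  rewrite ltn_eqF // (negPf (h i _)) //= andbT; case: (boolP (i.+1 \in C)) => //= sC'.
  by rewrite swap_i map_swap_id // h.
case: (eqVneq x i.+1) => [xE|xsi] /=; last first.
  by case: ifP => //= _; rewrite /swap (negPf xi) (negPf xsi).
by rewrite (negPf (h i _)) //=; lia.
Qed.

Lemma E_column C : sorted ltn C -> E_word i (rev C) =
  if (i.+1 \in C) && (i \notin C) then Some (rev (map swap C)) else None.
Proof.
elim: C => [//|x C IHC] /= xC; have sC := path_sorted xC.
rewrite !rev_cons -!cats1 E_word_cat phi_word1 E_word1 eps_column // IHC // !inE.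
have := lt_notin xC.
rewrite ![_ == x]eq_sym; case: (eqVneq x i) => [->|xi] h /=.
  by rewrite ltn_eqF // andbF; case: (_ \in C); case: (_ \in C).
case: (eqVneq x i.+1) => [xE|xsi] /=; last first.
  by case: (i.+1 \in C); case: (i \in C) => //=; rewrite /swap (negPf xi) (negPf xsi).
rewrite (negPf (h i _)) ?(negPf (h i.+1 _)) /=; try lia.
by rewrite xE swap_iS map_swap_id // h //; lia.
Qed.

End ColumnCrystal.

(** * Crystal operators preserve semistandardness and shape *)

Section FillingCrystal.

Variables (n i : nat).
Hypothesis i_range : 1 <= i < n.

Lemma all_map_swap C : all (fun x => 1 <= x <= n) C ->
  all (fun x => 1 <= x <= n) (map (swap i) C).
Proof.
move=> h; rewrite all_map; apply: sub_all h => x /=; rewrite /swap.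
by do ! case: ifP; lia.
Qed.

Lemma reading_cons C cs : reading (C :: cs) = rev C ++ reading cs.
Proof. by []. Qed.

Lemma filling_cons e1 e2 C cs : filling e1 e2 n (C :: cs) =
  [&& 0 < size C, all (fun x => 1 <= x <= n) C, sorted e1 C,
      dominates e2 C (head [::] cs) & filling e1 e2 n cs].
Proof.
rewrite /filling /= path_dominates.
by rewrite -!andbA; do ! bool_congr.
Qed.

Lemma filling_swap e2 C cs : filling ltn e2 n (C :: cs) -> (i \in C) != (i.+1 \in C) ->
    dominates e2 (map (swap i) C) (head [::] cs) ->
  filling ltn e2 n (map (swap i) C :: cs).
Proof.
rewrite !filling_cons size_map => /and5P[-> /all_map_swap -> /sorted_map_swap h _ ->] /h -> ->.
by [].
Qed.

(** The first column has nothing to its left, so an [i] in it can be cancelled only inside that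
    column. *)
Lemma phi_reading_head cs : filling ltn leq n cs -> phi_word i (reading cs) = 0 ->
  i \in head [::] cs -> i.+1 \in head [::] cs.
Proof.
case: cs => [//|C cs] fC; rewrite reading_cons phi_word_cat => /eqP.
move: fC; rewrite filling_cons addn_eq0 => /and5P[_ _ sC _ _] /andP[+ _] /= iC.
by rewrite phi_column // iC /=; case: (_ \in C).
Qed.

(** The last clause carries the induction: the head column can only grow entrywise, so the column to
    its left still dominates it. *)
Lemma F_reading cs w : filling ltn leq n cs -> F_word i (reading cs) = Some w ->
  exists cs', [/\ filling ltn leq n cs', reading cs' = w,
    [seq size C | C <- cs'] = [seq size C | C <- cs]
    & dominates leq (head [::] cs) (head [::] cs')].
Proof.
elim: cs w => [//|C cs IHcs] w fC; rewrite reading_cons F_word_cat.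
move: (fC); rewrite filling_cons => /and5P[C0 eC sC dC fcs].
case: ltnP => h.
  case Ew: (F_word i (reading cs)) => [v|//] [<-].
  have [cs' [fcs' <- szcs' dcs']] := IHcs v fcs Ew.
  exists (C :: cs'); split=> //=; last 1 first.
  - by apply/dominatesP.
  - by rewrite filling_cons C0 eC sC fcs' andbT (dominates_leq_trans dC dcs').
  - by rewrite szcs'.
rewrite F_column //; case: ifP => //= /andP[iC sC'] [<-].
have phi0 : phi_word i (reading cs) = 0.
  by move: h; rewrite eps_column // (negPf sC') /=; lia.
exists (map (swap i) C :: cs); split; rewrite /= ?size_map //; last first.
  apply/dominatesP; split; rewrite ?size_map // => k kC; rewrite nth_map_swap //.
  rewrite /swap; case: eqP => [->//|_]; case: eqP => [E|//].
  by rewrite -E mem_nth in sC'.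
apply: filling_swap => //; first by rewrite iC (negPf sC').
have /dominatesP[szD hD] := dC; have := phi_reading_head fcs phi0.
set D := head _ _ in hD szD *; move=> iD.
apply/dominatesP; split; rewrite ?size_map // => k kD.
have kC := leq_trans kD szD; rewrite nth_map_swap // /swap.
case: (eqVneq (nth 0 C k) i) => [Ck|_]; last first.
  by case: eqP => [E|_]; [rewrite -E mem_nth in sC' | apply: hD].
(* If [D] also had [i] in row [k], then by [iD] it would have [i.+1] in a lower row [j], and [C]
   would be squeezed to [i.+1] in row [j], against [sC']. *)
rewrite ltn_neqAle -{2}Ck hD // andbT; apply/eqP => Dk.
have iD' : i \in D by rewrite Dk mem_nth.
have sD : sorted ltn D.
  by rewrite /D; case: (cs) fcs => [//|D' cs']; rewrite filling_cons => /and5P[].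
have jD := iD iD'; set j := index i.+1 D.
have jD' : j < size D by rewrite index_mem.
have Dj : nth 0 D j = i.+1 by rewrite nth_index.
have kj : k < j.
  case: (ltngtP k j) => // [jk|kj]; last by move: Dj; rewrite -kj -Dk; lia.
  by have := sorted_ltn_nth ltn_trans 0 sD j k jD' kD jk; rewrite Dj -Dk /=; lia.
have Cj : nth 0 C j <= i.+1 by rewrite -Dj hD.
have jC : j < size C := leq_trans jD' szD.
have : nth 0 C k < nth 0 C j by apply: (sorted_ltn_nth ltn_trans) => //.
rewrite Ck => Cj'; have Cj2 : nth 0 C j = i.+1 by lia.
by rewrite -Cj2 mem_nth in sC'.
Qed.

(** The head column may shrink entrywise, which could break the condition with the column on its
    left. The last clause records that this happens only when [phi_word] of the reading vanishes; a
    column on the left that the operator passes by then contains [i] whenever it contains [i.+1]. *)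
Lemma E_reading cs w : filling ltn leq n cs -> E_word i (reading cs) = Some w ->
  exists cs', [/\ filling ltn leq n cs', reading cs' = w,
    [seq size C | C <- cs'] = [seq size C | C <- cs]
    & head [::] cs' = head [::] cs \/
      [/\ head [::] cs' = map (swap i) (head [::] cs), phi_word i (reading cs) = 0,
          i.+1 \in head [::] cs & i \notin head [::] cs]].
Proof.
elim: cs w => [//|C cs IHcs] w fC; rewrite reading_cons E_word_cat phi_word_cat.
move: (fC); rewrite filling_cons => /and5P[C0 eC sC dC fcs].
case: ltnP => h; last first.
  case Ew: (E_word i (reading cs)) => [v|//] [<-].
  have [cs' [fcs' <- szcs' hd]] := IHcs v fcs Ew.
  exists (C :: cs'); split=> //=; [|by rewrite szcs'|by left].
  rewrite filling_cons C0 eC sC fcs' andbT /=.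
  case: hd => [->//|[-> phi0 iS iN]].
  move: h; rewrite phi0 eps_column // => h.
  have {h} CS : i.+1 \in C -> i \in C by move=> iC; move: h; rewrite iC; case: (i \in C).
  have /dominatesP[szD hD] := dC; set D := head _ _ in iS iN szD hD *.
  apply/dominatesP; rewrite size_map; split=> // k kD; rewrite nth_map_swap //.
  have kC := leq_trans kD szD; rewrite /swap; case: eqP => [Dk|_].
    by rewrite -Dk mem_nth in iN.
  case: eqP => [Dk|_]; last exact: hD.
  (* If [C] also had [i.+1] in row [k], then by [CS] it would have [i] in a higher row [j], and [D]
     would be squeezed to [i] in row [j], against [iN]. *)
  rewrite -ltnS ltn_neqAle -{2}Dk hD // andbT; apply/eqP => Ck.
  have iC : i \in C by apply: CS; rewrite -Ck mem_nth.
  set j := index i C; have jC : j < size C by rewrite index_mem.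
  have Cj : nth 0 C j = i by rewrite nth_index.
  have jk : j < k.
    case: (ltngtP j k) => // [kj|jk]; last by move: Cj; rewrite jk Ck; lia.
    by have := sorted_ltn_nth ltn_trans 0 sC k j kC jC kj; rewrite Cj Ck /=; lia.
  have sD : sorted ltn D.
    by rewrite /D; case: (cs) fcs => [//|D' cs'']; rewrite filling_cons => /and5P[].
  have jD : j < size D := ltn_trans jk kD.
  have := sorted_ltn_nth ltn_trans 0 sD j k jD kD jk; have := hD j jD.
  rewrite Cj Dk /= => h1 h2; have Dj : nth 0 D j = i by lia.
  by rewrite -Dj mem_nth in iN.
rewrite E_column //; case: ifP => //= /andP[iC iN] [<-].
move: h; rewrite eps_column // iC iN ltnS leqn0 => /eqP phi0.
exists (map (swap i) C :: cs); split; rewrite /= ?size_map //; last first.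
  by right; split; rewrite // phi0 phi_column // iC andbF.
apply: filling_swap => //; first by rewrite iC (negPf iN).
have /dominatesP[szD hD] := dC.
apply/dominatesP; split; rewrite ?size_map // => k kD.
have kC := leq_trans kD szD; rewrite nth_map_swap //.
apply: leq_trans (hD k kD); rewrite /swap; case: eqP => [E|_]; last by case: eqP => //; lia.
by rewrite -E mem_nth in iN.
Qed.

Definition B_word w := if odd (phi_word i w) then F_word i w else E_word i w.

Definition deg_word w := if odd (phi_word i w) then (eps_word i w).+1 else eps_word i w.

Lemma B_reading cs w : filling ltn leq n cs -> B_word (reading cs) = Some w ->
  exists cs', [/\ filling ltn leq n cs', reading cs' = w
    & [seq size C | C <- cs'] = [seq size C | C <- cs]].
Proof.
move=> fcs; rewrite /B_word; case: ifP => _.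
  by case/(F_reading fcs) => cs' []; exists cs'.
by case/(E_reading fcs) => cs' []; exists cs'.
Qed.

Lemma knuth_B w w' : knuth w w' -> option_knuth (B_word w) (B_word w').
Proof.
move=> h; rewrite /B_word (knuth_phi i h).
by case: ifP => _; [apply: knuth_F | apply: knuth_E].
Qed.

Lemma knuth_deg w w' : knuth w w' -> deg_word w = deg_word w'.
Proof. by move=> h; rewrite /deg_word (knuth_phi i h) (knuth_eps i h). Qed.

Lemma BtildeE T : Btilde i T = omap (with_CR T) (B_word (CR T)).
Proof. by rewrite /Btilde /B_word /Ftilde /Etilde /phi; case: ifP. Qed.

Lemma size_head_eq (X Y : seq (seq nat)) :
  [seq size s | s <- X] = [seq size s | s <- Y] -> size (head [::] X) = size (head [::] Y).
Proof. by case: X Y => [|s X] [|t Y] //= [->]. Qed.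

Lemma Btilde_filling T T' : filling leq ltn n T -> Btilde i T = Some T' ->
  exists cs, [/\ filling ltn leq n cs, B_word (CR T) = Some (reading cs),
    T' = columns cs & [seq size C | C <- cs] = [seq size C | C <- columns T]].
Proof.
move=> fT; rewrite BtildeE; case E: (B_word (CR T)) => [w|//] [<-].
have [cs [fcs cw sz]] := B_reading (filling_columns fT) E.
exists cs; rewrite cw; split=> //; rewrite -cw with_CR_reading // (size_head_eq sz).
by rewrite -size_columns (filling_columnsK fT).
Qed.

(** Replaces refilling the shape by taking the P-symbol, which depends only on the Knuth class. *)
Lemma Btilde_Psymbol_CR T : filling leq ltn n T ->
  Btilde i T = omap Psymbol (B_word (CR T)).
Proof.
move=> fT; case E: (Btilde i T) => [T'|].
  have [cs [fcs -> -> _]] := Btilde_filling fT E.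
  by rewrite /= (Psymbol_reading fcs).
by move: E; rewrite BtildeE; case: (B_word _).
Qed.

End FillingCrystal.

Lemma Psymbol_CR n T : filling leq ltn n T -> Psymbol (CR T) = T.
Proof.
by move=> fT; rewrite (Psymbol_reading (filling_columns fT)) (filling_columnsK fT).
Qed.

(** Both words are Knuth equivalent to the row reading of the same tableau. *)
Lemma knuth_CR n w : all (fun x => 1 <= x <= n) w -> knuth w (CR (Psymbol w)).
Proof.
move=> wn; apply: KnuthTrans (knuth_row_reading w) (KnuthSym _).
by have := knuth_row_reading (CR (Psymbol w)); rewrite (Psymbol_CR (Psymbol_filling wn)).
Qed.

Lemma Btilde_Psymbol n i w : 1 <= i < n -> all (fun x => 1 <= x <= n) w ->
  Btilde i (Psymbol w) = omap Psymbol (B_word i w).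
Proof.
move=> ri wn; rewrite (Btilde_Psymbol_CR ri (Psymbol_filling wn)).
have := knuth_B i (knuth_CR wn).
by case: (B_word i w) (B_word i (CR _)) => [u|] [v|] //= /knuth_Psymbol ->.
Qed.

Lemma deg_Psymbol n i w : all (fun x => 1 <= x <= n) w -> deg i (Psymbol w) = deg_word i w.
Proof. by move=> /knuth_CR /(knuth_deg i) ->. Qed.

(** * The map K_1 *)

Section ColumnComplement.

Variable n : nat.
Implicit Type i : nat.

Lemma Kcol_sorted C : sorted ltn (Kcol n C).
Proof. by apply: sorted_filter; [exact: ltn_trans | exact: iota_ltn_sorted]. Qed.

Lemma mem_Kcol C x : (x \in Kcol n C) = (x \notin C) && (1 <= x <= n).
Proof. by rewrite mem_filter mem_iota add1n ltnS. Qed.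

Lemma Kcol_range C : all (fun x => 1 <= x <= n) (Kcol n C).
Proof. by apply/allP => x; rewrite mem_Kcol => /andP[]. Qed.

Lemma size_Kcol C : sorted ltn C -> all (fun x => 1 <= x <= n) C ->
  size (Kcol n C) = n - size C.
Proof.
move=> sC eC; have uC := sorted_uniq ltn_trans ltnn sC.
have E : perm_eq (filter (mem C) (iota 1 n)) C.
  apply: uniq_perm; rewrite ?filter_uniq ?iota_uniq // => x; rewrite mem_filter /=.
  by case: (boolP (x \in C)) => //= /(column_in_iota eC).
have := count_predC (mem C) (iota 1 n); rewrite size_iota -!size_filter (perm_size E).
by move=> {2}<-; rewrite addKn.
Qed.

Lemma Kcol_swap i C : 1 <= i < n -> (i \in C) != (i.+1 \in C) ->
  Kcol n (map (swap i) C) = map (swap i) (Kcol n C).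
Proof.
move=> ri iC; apply: (irr_sorted_eq ltn_trans ltnn); first exact: Kcol_sorted.
  apply: sorted_map_swap; first exact: Kcol_sorted.
  by rewrite !mem_Kcol; move: iC; case: (i \in C); case: (i.+1 \in C); lia.
move=> x; rewrite mem_map_swap !mem_Kcol mem_map_swap; congr (_ && _).
by rewrite /swap; case: (eqVneq x i) => [->|_]; [|case: (eqVneq x i.+1) => [->|_]]; lia.
Qed.

(** Let [p] and [e] be [phi_word] and [eps_word] of [v]. If exactly one of the two letters lies in
    [C], the pairs for the two words are, in some order, [(p + 1, e)] and either [(p - 1, e)] when
    [p > 0] or [(0, e + 1)] when [p = 0]; both give the same degree. Otherwise complementing changes
    neither number. *)
Lemma deg_word_Kcol i C v : 1 <= i < n -> sorted ltn C ->
  deg_word i (rev (Kcol n C) ++ v) = deg_word i (rev C ++ v).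
Proof.
move=> ri sC; rewrite /deg_word !phi_word_cat !eps_word_cat.
rewrite !phi_column ?Kcol_sorted // !eps_column ?Kcol_sorted // !mem_Kcol.
have [-> ->] : 1 <= i <= n /\ 1 <= i.+1 <= n by lia.
move: (phi_word i v) (eps_word i v) => p e.
by case: (i \in C); case: (i.+1 \in C) => /=; case: p => [|p] /=;
  rewrite ?subn0 ?subn1 ?addn0 ?add0n ?addn1 //=; case: (odd p).
Qed.

(** The results must again differ by complementing a first column; recording that its length is that
    of [C] makes the factorisation of [w] unique. *)
Definition complement_match C (o o' : option word) : Prop :=
  if o is Some w then
    exists C' v', [/\ w = rev C' ++ v', size C' = size C
                    & o' = Some (rev (Kcol n C') ++ v')]
  else o' = None.

(** If [C] contains exactly one of the two letters and [phi_word i v = 0], one side applies [F] and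
    the other [E], both to the column, and both act there by [swap]. In all other cases the same
    operator is applied to [v] on both sides. *)
Lemma B_word_Kcol i C v : 1 <= i < n -> sorted ltn C ->
  complement_match C (B_word i (rev C ++ v)) (B_word i (rev (Kcol n C) ++ v)).
Proof.
move=> ri sC; rewrite /B_word !phi_word_cat !F_word_cat !E_word_cat.
rewrite !phi_column ?Kcol_sorted // !eps_column ?Kcol_sorted //.
rewrite !F_column ?Kcol_sorted // !E_column ?Kcol_sorted // !mem_Kcol.
have [-> ->] : 1 <= i <= n /\ 1 <= i.+1 <= n by lia.
have keep o : complement_match C (omap (cat (rev C)) o) (omap (cat (rev (Kcol n C))) o).
  by case: o => //= v'; exists C, v'.
have swapC : (i \in C) != (i.+1 \in C) ->
    complement_match C (Some (rev (map (swap i) C) ++ v))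
      (Some (rev (map (swap i) (Kcol n C)) ++ v)).
  by move=> iC; exists (map (swap i) C), v; rewrite size_map Kcol_swap.
move: (phi_word i v) swapC => p.
case: (i \in C); case: (i.+1 \in C) => /= sw; case: p => [|[|p]];
  rewrite ?subn1 ?add0n /= ?negbK //; try exact: sw; by case: ifP.
Qed.

End ColumnComplement.

(** * Longest decreasing subwords as a lower bound for the number of rows *)

Section LongestDecreasing.

(** Length of the longest strictly decreasing subword of [w] with letters
    below [b]. *)
Fixpoint decr_length (b : nat) (w : word) : nat :=
  if w is x :: w' then
    if x < b then maxn (decr_length x w').+1 (decr_length b w')
    else decr_length b w'
  else 0.

Lemma decr_length_mono b b' w : b <= b' -> decr_length b w <= decr_length b' w.
Proof.
elim: w b b' => [//|x w IHw] b b' bb' /=; have IH := IHw _ _ bb'.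
case: (ltnP x b) => xb; case: (ltnP x b') => xb'; lia.
Qed.

(** Letting [b] vary absorbs the prefix [u]; a single move in front of [v] is then settled by
    monotonicity in the bound. *)
Lemma knuth_decr_length b w w' : knuth w w' -> decr_length b w = decr_length b w'.
Proof.
apply: (knuth_inv (f := decr_length b)) => u v m m' st.
elim: u b => [|a u IHu] b /=; last by rewrite !IHu.
have mono := decr_length_mono v.
case: st => x y z xy yz /=.
  have [zyF zxF xzT] : [/\ z < y = false, z < x = false & x < z] by split; lia.
  rewrite zyF xy xzT zxF; move: (mono x y) (mono y z) (mono x b) (mono y b) (mono z b) => {mono}.
  move: (decr_length x v) (decr_length y v) (decr_length z v) (decr_length b v) => X Y Z B.
  by case: (ltnP x b); case: (ltnP y b); case: (ltnP z b); lia.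
have [zxF yxF xzT] : [/\ z < x = false, y < x = false & x < z] by split; lia.
rewrite zxF yz xzT yxF; move: (mono x y) (mono y z) (mono x b) (mono y b) (mono z b) => {mono}.
move: (decr_length x v) (decr_length y v) (decr_length z v) (decr_length b v) => X Y Z B.
by case: (ltnP x b); case: (ltnP y b); case: (ltnP z b); lia.
Qed.

Lemma subseq_decr_length b s w : subseq s w -> sorted gtn s -> all (ltn^~ b) s ->
  size s <= decr_length b w.
Proof.
elim: w s b => [|x w IHw] s b; first by rewrite subseq0 => /eqP ->.
case: s => [//|y s] /=; case: eqP => [->|_] sub ys /andP[yb sb].
  rewrite yb leq_max ltnS IHw ?(path_sorted ys) //.
  by have := order_path_min (rev_trans ltn_trans) ys.
have := IHw (y :: s) b sub ys; rewrite /= yb sb => /(_ isT).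
by case: ifP => _ //; rewrite leq_max => ->; rewrite orbT.
Qed.

(** A weakly increasing row contributes at most one letter to a strictly decreasing subword. *)
Lemma decr_length_row b r w : sorted leq r -> decr_length b (r ++ w) <= (decr_length b w).+1.
Proof.
have skip c s : all (leq c) s -> decr_length c (s ++ w) = decr_length c w.
  by elim: s => [//|x s IHs] /= /andP[cx /IHs ->]; rewrite ltnNge cx.
elim: r => [//|x r IHr] sr /=; have IH := IHr (path_sorted sr).
case: ltnP => // xb; rewrite geq_max IH andbT ltnS skip; last exact: order_path_min leq_trans sr.
exact/decr_length_mono/ltnW.
Qed.

Lemma decr_length_rows b (R : seq (seq nat)) : all (sorted leq) R ->
  decr_length b (flatten R) <= size R.
Proof.
elim: R => [//|r R IHR] /= /andP[sr /IHR IH].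
exact: leq_trans (decr_length_row _ _ sr) _.
Qed.

(** One half of Schensted's theorem: the row reading is a concatenation of [size (Psymbol w)] weakly
    increasing words. *)
Lemma decr_length_Psymbol b w : decr_length b w <= size (Psymbol w).
Proof.
rewrite (knuth_decr_length b (knuth_row_reading w)) -(size_rev (Psymbol w)).
apply: decr_length_rows; rewrite all_rev; exact: foldl_row_insert_sorted.
Qed.

End LongestDecreasing.

(** * AI-tableaux, iteration of [K1], and the map [PAI] *)

Section AICrystal.

Variable n : nat.

Notation tab := (filling leq ltn n).

Lemma K1E T : K1 n T =
  Psymbol (rev (Kcol n (head [::] (columns T))) ++ reading (behead (columns T))).
Proof. by []. Qed.

Lemma reading_head cs : reading cs = rev (head [::] cs) ++ reading (behead cs).
Proof. by case: cs. Qed.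

Lemma CR_split T : CR T = rev (head [::] (columns T)) ++ reading (behead (columns T)).
Proof. exact: reading_head. Qed.

Lemma reading_range e1 e2 cs : filling e1 e2 n cs -> all (fun x => 1 <= x <= n) (reading cs).
Proof.
elim: cs => [//|C cs IHcs]; rewrite filling_cons => /and5P[_ eC _ _ fcs].
by rewrite all_cat all_rev eC IHcs.
Qed.

Lemma filling_head e1 e2 cs : filling e1 e2 n cs ->
  sorted e1 (head [::] cs) && all (fun x => 1 <= x <= n) (head [::] cs).
Proof. by case: cs => [//|C cs]; rewrite filling_cons => /and5P[_ -> -> _ _]. Qed.

Lemma filling_behead e1 e2 cs : filling e1 e2 n cs -> filling e1 e2 n (behead cs).
Proof. by case: cs => [//|C cs]; rewrite filling_cons => /and5P[]. Qed.

Lemma K1_word_range T : tab T ->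
  all (fun x => 1 <= x <= n)
    (rev (Kcol n (head [::] (columns T))) ++ reading (behead (columns T))).
Proof.
move=> fT; rewrite all_cat all_rev Kcol_range.
exact: reading_range (filling_behead (filling_columns fT)).
Qed.

Lemma K1_filling T : tab T -> tab (K1 n T).
Proof. by move=> fT; rewrite K1E; apply/Psymbol_filling/K1_word_range. Qed.

Lemma iter_K1_filling (r : nat) T : tab T -> tab (iter r (K1 n) T).
Proof. by move=> fT; elim: r => //= r; apply: K1_filling. Qed.

Lemma size_head_column T : tab T -> size (head [::] (columns T)) = size T.
Proof. by move=> fT; rewrite -size_columns (filling_columnsK fT). Qed.

Lemma deg_K1 i T : 1 <= i < n -> tab T -> deg i (K1 n T) = deg i T.
Proof.
move=> ri fT; rewrite K1E (deg_Psymbol i (K1_word_range fT)).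
rewrite (deg_word_Kcol _ ri) -?CR_split //.
by case/andP: (filling_head (filling_columns fT)).
Qed.

Lemma Btilde_tab i T T' : 1 <= i < n -> tab T -> Btilde i T = Some T' ->
  tab T' /\ size T' = size T.
Proof.
move=> ri fT /(Btilde_filling ri fT)[cs [fcs _ -> sz]].
by rewrite (filling_columns fcs) size_columns (size_head_eq sz) size_head_column.
Qed.

Lemma Btilde_K1 i T : 1 <= i < n -> tab T ->
  omap (K1 n) (Btilde i T) = Btilde i (K1 n T).
Proof.
move=> ri fT; rewrite K1E (Btilde_Psymbol ri (K1_word_range fT)).
have fc := filling_columns fT; have /andP[sC _] := filling_head fc.
have := B_word_Kcol (reading (behead (columns T))) ri sC; rewrite -CR_split.
case E: (Btilde i T) => [T'|]; last first.
  by move: E; rewrite BtildeE; case: (B_word i (CR T)) => //= _ ->.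
have [cs [fcs -> -> sz]] := Btilde_filling ri fT E.
case=> C' [v' [Ew szC' ->]] /=; congr Some; rewrite K1E (filling_columnsK fcs).
move: Ew; rewrite reading_head => /eqP.
rewrite eqseq_cat ?size_rev ?szC' ?(size_head_eq sz) // => /andP[/eqP/(can_inj revK) -> /eqP ->].
by [].
Qed.

Lemma Btilde_iter_K1 i (r : nat) T : 1 <= i < n -> tab T ->
  omap (iter r (K1 n)) (Btilde i T) = Btilde i (iter r (K1 n) T).
Proof.
move=> ri fT; elim: r => [|r IHr] /=; first by case: (Btilde i T).
by rewrite -Btilde_K1 ?iter_K1_filling // -IHr; case: (Btilde i T).
Qed.

Lemma deg_iter_K1 i (r : nat) T : 1 <= i < n -> tab T -> deg i (iter r (K1 n) T) = deg i T.
Proof. by move=> ri fT; elim: r => //= r <-; rewrite deg_K1 // iter_K1_filling. Qed.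

(** Complementing the first column changes the number of cells by [n - 2 d_1], and insertion keeps
    the number of letters; the additive form avoids truncated subtraction. *)
Lemma size_CR_K1 T : tab T -> size (CR (K1 n T)) + size T + size T = n + size (CR T).
Proof.
move=> fT; have fc := filling_columns fT; have /andP[sC eC] := filling_head fc.
rewrite K1E -(perm_size (knuth_perm (knuth_CR (K1_word_range fT)))).
rewrite [CR T in RHS]CR_split !size_cat !size_rev size_Kcol // size_head_column //.
by have := filling_size fT; move: (size T) (size (reading _)) => a b; lia.
Qed.

(** A violation [K(C_1)_i > (C_2)_i] produces a decreasing subword of length
    [n - d_1 + 1] in the reading of [K(C_1), C_2, ...]. *)
Lemma K1_long T : tab T -> size T <= n./2 -> ~~ is_AI n T -> n - size T < size (K1 n T).
Proof.
move=> fT sT; have fc := filling_columns fT; have dT := filling_decreasing fT.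
have /andP[sC eC] := filling_head fc.
rewrite /is_AI -!nth_columns // nth0 size_head_column // sT /=.
set K := Kcol n _; set D := nth _ _ 1; move/allPn => [i]; rewrite mem_iota /= add0n => iD.
rewrite -ltnNge => DK.
have szK : size K = n - size T by rewrite size_Kcol // size_head_column.
have szD : size D <= size T.
  have := decreasing_columns dT => /decreasingP/(_ 0).
  by rewrite nth0 size_head_column.
have iK : i < size K by rewrite szK; lia.
have sK : sorted ltn K := Kcol_sorted n _.
have sD : sorted ltn D.
  by rewrite /D -nth_behead nth0; case/andP: (filling_head (filling_behead fc)).
(* Since [D] has a smaller entry than [K] at index [i], the first [i + 1] entries of [D] followed by
   the entries of [K] from index [i] on increase strictly; both lists keep index [i], whence the
   extra letter. *)
pose s := rev (take i.+1 D ++ drop i K).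
have sz : size s = (n - size T).+1.
  by rewrite size_rev size_cat size_drop size_takel // szK; lia.
(* The bound [n.+1] admits every letter of the alphabet. *)
rewrite -sz K1E; apply: leq_trans (decr_length_Psymbol n.+1 _); apply: subseq_decr_length.
- rewrite /s rev_cat cat_subseq ?subseq_rev ?drop_subseq //.
  rewrite reading_head -nth0 nth_behead; apply: subseq_trans (prefix_subseq _ _).
  by rewrite subseq_rev take_subseq.
- rewrite /s rev_sorted (take_nth 0) // (drop_nth 0) //.
  have sD' : sorted ltn (rcons (take i D) (nth 0 D i)).
    by rewrite -take_nth //; apply: take_sorted.
  have sK' : sorted ltn (nth 0 K i :: drop i.+1 K).
    by rewrite -drop_nth //; apply: drop_sorted.
  case: (take i D) sD' => [|x t] /= sD'; first by rewrite DK.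
  by rewrite cat_path last_rcons sD' /= DK.
rewrite all_rev all_cat; apply/andP; split; apply/allP => x.
  move/mem_take => xD; have /andP[_ /allP/(_ x)] := filling_head (filling_behead fc).
  by rewrite -nth0 nth_behead => /(_ xD) /andP[].
by move/mem_drop; rewrite mem_Kcol => /and3P[].
Qed.

(** For an AI-tableau, [K(C_1), C_2, ...] are already the columns of a semistandard tableau, so [K1]
    returns that tableau, whose first column has length [n - d_1]. The converse is [K1_long]. *)
Lemma is_AI_size T : 1 < n -> tab T ->
  is_AI n T = (size T <= n./2) && (size (K1 n T) == n - size T).
Proof.
move=> n1 fT; have fc := filling_columns fT; have dT := filling_decreasing fT.
have /andP[sC eC] := filling_head fc.
apply/idP/andP => [AI|[sT /eqP sK1]]; last first.
  by apply: contraT => /(K1_long fT sT); rewrite sK1 ltnn.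
move: (AI); rewrite /is_AI -!nth_columns // nth0 size_head_column // => /andP[sT /allP AI2].
split=> //; rewrite K1E.
set cs := columns T in fc sC eC AI2 *; set K := Kcol n _ in AI2 *.
have szK : size K = n - size T by rewrite size_Kcol // size_head_column.
have fK : filling ltn leq n (K :: behead cs).
  rewrite filling_cons szK Kcol_range Kcol_sorted (filling_behead fc) andbT /=.
  apply/andP; split; first by move: (size T) sT n1; clear=> a; lia.
  have := decreasing_columns dT => /decreasingP/(_ 0).
  rewrite nth0 size_head_column // -nth_behead nth0 => szD.
  have AI3 k : k < size (head [::] (behead cs)) ->
      nth 0 K k <= nth 0 (head [::] (behead cs)) k.
    by have := AI2 k; rewrite mem_iota /= -nth_behead nth0.
  apply/dominatesP; split=> //; apply: leq_trans szD _.
  by have -> : size K = n - size T := szK; move: (size T) sT => a; lia.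
by rewrite (Psymbol_reading fK) size_columns /= szK.
Qed.

(** Strong induction on the number of cells. If [d_1 > n./2], one application of [K1] removes
    [2 d_1 - n > 0] cells. Otherwise [K1] adds [n - 2 d_1] cells but leaves at least [n - d_1 + 1]
    rows, so a second application removes at least two cells more than were added. *)
Lemma ex_AI T : 1 < n -> tab T -> exists r : nat, is_AI n (iter r (K1 n) T).
Proof.
move=> n1; have [N] := ubnP (size (CR T)); elim: N T => // N IHN T szN fT.
have [AI|nAI] := boolP (is_AI n T); first by exists 0.
have fT1 := K1_filling fT; have sz1 := size_CR_K1 fT; have sz2 := size_CR_K1 fT1.
have le_size U : tab U -> size U <= size (CR U).
  by move=> fU; rewrite CR_split size_cat size_rev size_head_column // leq_addr.
have leT := le_size T fT; have leT1 := le_size _ fT1.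
have [sT|sT] := leqP (size T) n./2.
  have long := K1_long fT sT nAI.
  have [||r AI] := IHN (K1 n (K1 n T)); [|exact: K1_filling|].
    move: sz1 sz2 leT leT1 szN sT long.
    move: (size T) (size (K1 n T)) (size (CR T)) (size (CR _)) (size (CR _)) => a b c d e.
    lia.
  by exists r.+2; rewrite !iterSr.
have [||r AI] := IHN (K1 n T); [|exact: K1_filling|].
  have := filling_size fT; move: sz1 leT szN sT.
  move: (size T) (size (CR T)) (size (CR _)) => a b c; lia.
by exists r.+1; rewrite iterSr.
Qed.

Lemma PAI_min T : 1 < n -> tab T ->
  exists r : nat, [/\ PAI n T = iter r (K1 n) T, is_AI n (iter r (K1 n) T)
              & forall k, is_AI n (iter k (K1 n) T) -> r <= k].
Proof.
move=> n1 fT; rewrite /PAI; case: pselect => [ex_r|]; last by case; apply: ex_AI.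
by case: ex_minnP => r AI min_r; exists r.
Qed.

Lemma is_AI_Btilde i T T' : 1 < n -> 1 <= i < n -> tab T -> Btilde i T = Some T' ->
  is_AI n T' = is_AI n T.
Proof.
move=> n1 ri fT BT; have [fT' szT'] := Btilde_tab ri fT BT.
rewrite !is_AI_size // szT'; have := Btilde_K1 ri fT; rewrite BT /= => /esym BK.
by have [_ ->] := Btilde_tab ri (K1_filling fT) BK.
Qed.

Lemma PAI_Btilde i T : 1 < n -> 1 <= i < n -> tab T ->
  omap (PAI n) (Btilde i T) = Btilde i (PAI n T).
Proof.
move=> n1 ri fT; have [r [-> AI min_r]] := PAI_min n1 fT.
rewrite -Btilde_iter_K1 //; case BT: (Btilde i T) => [T'|//] /=; congr Some.
have AIiter k : is_AI n (iter k (K1 n) T') = is_AI n (iter k (K1 n) T).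
  apply: (is_AI_Btilde n1 ri (iter_K1_filling k fT)).
  by rewrite -Btilde_iter_K1 // BT.
have [fT' _] := Btilde_tab ri fT BT; have [r' [-> AI' min_r']] := PAI_min n1 fT'.
congr (iter _ _ _); apply/eqP; rewrite eqn_leq min_r' ?AIiter // min_r // -AIiter.
exact: AI'.
Qed.

End AICrystal.

Theorem proposition2p5p12 (n : nat) (hn : 3 <= n) :
  (forall (lam : seq nat) (T : tableau), Par n lam -> SST n lam T ->
     exists2 rho : seq nat, Par n./2 rho & SST_AI n rho (PAI n T)) /\
  (forall (lam : seq nat) (T : tableau), Par n lam -> SST n lam T ->
     forall i : nat, 1 <= i <= n.-1 ->
       omap (PAI n) (Btilde i T) = Btilde i (PAI n T) /\
       deg i (PAI n T) = deg i T).
Proof.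
have n1 : 1 < n by apply: ltnW.
split=> lam T Plam /(SST_filling Plam) fT.
  have [r [-> AI _]] := PAI_min n1 fT; have fU := iter_K1_filling r fT.
  (* The characterisation by row counts also bounds the length of the resulting shape by [n./2]. *)
  have /andP[sU _] : _ && _ := etrans (esym (is_AI_size n1 fU)) AI.
  have [PU SU] := filling_SST sU fU.
  by exists (Defs.shape (iter r (K1 n) T)); rewrite // /SST_AI SU.
move=> i ri; have {}ri : 1 <= i < n by lia.
split; first exact: PAI_Btilde.
by have [r [-> _ _]] := PAI_min n1 fT; rewrite deg_iter_K1.
Qed.
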